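(* Suppose: (1) $\theta\le\lambda<\kappa$ are infinite cardinals with $\lambda,\kappa$ regular; (2) $c:\lambda\times\kappa\rightarrow\lambda$ is a strongly unbounded coloring; (3) $c$ is tight, and furthermore $(\mathrm{cf}(\mathcal T_c,\supseteq))^{<\theta}\le\kappa$; (4) $\mathcal S$ is a partition of some nonreflecting stationary subset of $E^{\kappa}_{\lambda}$ into stationary sets. Then there exists a club $C\subseteq\kappa$ such that $\clubsuit_{\mathrm{ad}}(\{S\cap C\mid S\in\mathcal S\},\lambda,{<}\theta)$ holds. If either $\kappa=\lambda^+$ or $\lambda^{<\lambda}=\lambda$, then $C$ can be taken to be $\kappa$.
   Context: $E^\kappa_\lambda=\{\alpha<\kappa\mid\mathrm{cf}(\alpha)=\lambda\}$. A stationary $S\subseteq\kappa$ is nonreflecting if there is no $\alpha<\kappa$ of uncountable cofinality with $S\cap\alpha$ stationary in $\alpha$. For a coloring $c:\lambda\times\kappa\rightarrow\lambda$ and $\beta<\kappa$, $c_\beta(\eta):=c(\eta,\beta)$. $c$ is strongly unbounded iff for every cofinal $B\subseteq\kappa$ there are $\eta<\lambda$ and $t:\eta\to\lambda$ with $\sup\{c_\beta(\eta)\mid\beta\in B,\ c_\beta\restriction\eta=t\}=\lambda$. For $\mathbb T\subseteq{}^{<\lambda}\lambda$, $[\mathbb T]_c:=\{\beta<\kappa\mid\forall\eta<\lambda\,(c_\beta\restriction\eta\in\mathbb T)\}$, $\mathcal T_c:=\{\mathbb T\subseteq{}^{<\lambda}\lambda\mid\sup([\mathbb T]_c)=\kappa\}$;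 $\mathrm{cf}(\mathcal T_c,\supseteq)$ is the least size of $\mathcal D\subseteq\mathcal T_c$ such that every member of $\mathcal T_c$ contains a member of $\mathcal D$; $c$ is tight iff $\mathrm{cf}(\mathcal T_c,\supseteq)\le\kappa$. For a collection $\mathcal S$ of stationary subsets of $\kappa$ and nonzero cardinals $\mu,\theta<\kappa$, $\clubsuit_{\mathrm{ad}}(\mathcal S,\mu,{<}\theta)$ asserts the existence of $\langle\mathcal A_\alpha\mid\alpha\in\bigcup\mathcal S\rangle$ such that: (i) for every limit ordinal $\alpha\in\bigcup\mathcal S$, $\mathcal A_\alpha$ is a pairwise disjoint family of $\mu$ many cofinal subsets of $\alpha$; (ii) for every $\mathcal B\subseteq[\kappa]^\kappa$ of size $<\theta$ and every $S\in\mathcal S$, there are stationarily many $\alpha\in S$ with $\sup(A\cap B)=\alpha$ for all $A\in\mathcal A_\alpha$, $B\in\mathcal B$; (iii) for all distinct $A,A'$ from $\bigcup_{S\in\mathcal S}\bigcup_{\alpha\in S}\mathcal A_\alpha$, $\sup(A\cap A')<\sup(A)$. *)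

(* Defs.v *)
From HB Require Import structures.
From mathcomp Require Import all_boot all_order.
From mathcomp Require Import boolp classical_sets functions cardinality wochoice.

Set Implicit Arguments.
Unset Strict Implicit.
Unset Printing Implicit Defensive.

Import Order.TTheory.
Local Open Scope order_scope.
Local Open Scope card_scope.
Local Open Scope classical_set_scope.

(* Ordinals are the elements of an arbitrary totally ordered type O whose order
   is a well-order, an ordinal [a] being identified with its set [below a] of
   predecessors; cardinals are initial ordinals. Every cardinal that has to be
   an element of O is at most kappa, so any O containing kappa is large enough:
   in particular cf(T_c) is in O as soon as it is at most kappa. *)
Section Ordinals.
Context {d : Order.disp_t} {O : orderType d}.
Implicit Types (a b k l m th : O) (A B C S : set O).

Definition well_ordered : Prop := well_order (<=%O : rel O).

Definition below a : set O := [set x | x < a].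

Definition seg a : Type := {x : O | x < a}.

Definition seg_widen a (b : seg a) (x : seg (sval b)) : seg a :=
  exist _ (sval x) (lt_trans (svalP x) (svalP b)).

Definition limit_ordinal a : Prop :=
  (exists b, b < a) /\ forall b, b < a -> exists2 x, b < x & x < a.

Definition is_cardinal a : Prop := forall b, b < a -> ~~ (below a #<= below b).

Definition infinite_cardinal a : Prop :=
  is_cardinal a /\ infinite_set (below a).

Definition is_succ_cardinal l k : Prop :=
  [/\ is_cardinal k, l < k & forall m, is_cardinal m -> l < m -> k <= m].

Definition card_lt (T U : Type) (X : set T) (Y : set U) : Prop :=
  X #<= Y /\ ~~ (Y #<= X).

Definition cofinal_in a A : Prop :=
  A `<=` below a /\ forall x, x < a -> exists2 y, A y & x <= y.

(* [sup A = a] and [sup A < sup B]; the supremum of the empty set is 0, the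
   least element of O. *)
Definition is_sup A a : Prop := supremums A a.

Definition sup_lt_sup A B : Prop :=
  exists a b, [/\ is_sup A a, is_sup B b & a < b].

Definition cofinal_map a b : Prop :=
  exists f : seg b -> seg a, cofinal_in a [set sval (f x) | x in [set: seg b]].

Definition is_cf a b : Prop :=
  cofinal_map a b /\ forall x, x < b -> ~ cofinal_map a x.

Definition regular_cardinal a : Prop := infinite_cardinal a /\ is_cf a a.

Definition uncountable_cf a : Prop :=
  exists2 b, is_cf a b & ~ countable (below b).

(* E^k_l *)
Definition cof_set k l : set O := [set a | a < k /\ is_cf a l].

Definition club a C : Prop :=
  cofinal_in a C /\
  forall b, b < a -> limit_ordinal b -> is_sup (C `&` below b) b -> C b.

Definition stationary a S : Prop :=
  S `<=` below a /\ forall C, club a C -> S `&` C !=set0.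

Definition nonreflecting k S : Prop :=
  ~ exists a, [/\ a < k, uncountable_cf a & stationary a (S `&` below a)].

(* The sequences of length < th with values in m, that is ^{<th}m; the cardinal
   power m^{<th} is the cardinality of this type. *)
Definition seqlt th m : Type := {e : seg th & seg (sval e) -> seg m}.

Section Colorings.
Variables (l k : O).
Implicit Types (c : seg l -> seg k -> seg l) (T : set (seqlt l l)).

(* c_beta restricted to e *)
Definition fiber_restr c (beta : seg k) (e : seg l) : seg (sval e) -> seg l :=
  fun x => c (seg_widen x) beta.
#[local] Arguments fiber_restr c beta e : clear implicits.

Definition strongly_unbounded c : Prop :=
  forall B, cofinal_in k B ->
    exists (e : seg l) (t : seg (sval e) -> seg l),
      is_sup [set sval (c e beta) |
                beta in [set beta : seg k | B (sval beta) /\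
                                            fiber_restr c beta e = t]] l.

(* [T]_c *)
Definition branches c T : set O :=
  [set sval beta |
     beta in [set beta : seg k | forall e : seg l,
                T (existT _ e (fiber_restr c beta e))]].

(* the family T_c *)
Definition big_trees c : set (set (seqlt l l)) :=
  [set T | is_sup (branches c T) k].

Definition dense_trees c (D : set (set (seqlt l l))) : Prop :=
  D `<=` big_trees c /\
  forall T, big_trees c T -> exists2 T', D T' & T' `<=` T.

(* cf(T_c, superset) = chi *)
Definition is_cf_trees c (chi : O) : Prop :=
  [/\ is_cardinal chi,
      exists2 D, dense_trees c D & D #= below chi &
      forall D, dense_trees c D -> below chi #<= D].

Definition tight c : Prop := exists2 chi, is_cf_trees c chi & chi <= k.

End Colorings.

(* The principle club_ad(SS, m, <th) on k; it is meant for a family SS of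
   stationary subsets of k and nonzero cardinals m, th < k. *)
Definition club_ad k (SS : set (set O)) m th : Prop :=
  exists AA : O -> set (set O),
  [/\ forall a, (\bigcup_(S in SS) S) a -> limit_ordinal a ->
        [/\ trivIset (AA a) id, AA a #= below m &
            forall A, AA a A -> cofinal_in a A],
      forall BB : set (set O),
        (forall B, BB B -> B `<=` below k /\ B #= below k) ->
        card_lt BB (below th) ->
        forall S, SS S ->
          stationary k [set a | S a /\
            forall A B, AA a A -> BB B -> is_sup (A `&` B) a] &
      forall A A',
        (\bigcup_(S in SS) \bigcup_(a in S) AA a) A ->
        (\bigcup_(S in SS) \bigcup_(a in S) AA a) A' ->
        A <> A' -> sup_lt_sup (A `&` A') A].

End Ordinals.
Arguments well_ordered {d} O.
Arguments fiber_restr {d O l k} c beta e _.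

(* Main.v *)
Require Import Defs.
From HB Require Import structures.
From mathcomp Require Import all_boot all_order.
From mathcomp Require Import boolp classical_sets functions cardinality wochoice.

Set Implicit Arguments.
Unset Strict Implicit.
Unset Printing Implicit Defensive.

Import Order.TTheory.
Local Open Scope order_scope.
Local Open Scope card_scope.
Local Open Scope classical_set_scope.

(* Write [c_b] for the function [z |-> c z b] and [Z] for the union of [SS].
   With each [a] in [Z] are associated fewer than [theta] trees of a dense
   family of big trees, every such sequence being used stationarily often in
   every member of [SS] (Solovay's splitting); with each of these trees come,
   for every index [j], some branches [g >= a] of the tree.  A ladder of length
   [lambda] cuts [a] into intervals, and a point [b] of the [j]-th one is put
   into a member of the family at [a] when, for one of the branches [g] with
   index [j], [c_b] agrees with [c_g] up to a level [z] at which [c_g z] exceeds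
   all [c_b y], [y <= m a b].

   The level [m a b] comes from a walk from [a] to [b]; as [Z] is nonreflecting,
   the walk passes through any given [a'] of [Z] below [a] once [b] is close
   enough to [a'].  Hence a [b] belonging to sets attached to [a] and to [a']
   would have to exceed, at a level bounded by [m a b], any value below
   [lambda] as [b] tends to [a'], whereas [c_g z] stays bounded: the sets are
   almost disjoint.  Given a cofinal [B], tightness yields a tree [T] contained
   in the tree of [B]; the set of the branches of [T] that are bounded at every
   node by the values needed below a given [dl] is not cofinal, by strong
   unboundedness.  So each large branch [g] of [T] leaves these bounds at some
   node, and a point of [B] below [dl] through this node is caught.

   The sets obtained are made cofinal in every [a] of [Z] by adding the ladder
   of [a].  The ladders are chosen so that a fixed function [e : O -> lambda]
   tends to [lambda] along each of them, and [e] is kept bounded on the rest of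
   the sets, so that almost disjointness is not lost. *)

(** * Cardinal inequalities as injections *)

Lemma card_le_inj T U (u0 : U) (A : set T) (B : set U) : A #<= B ->
  exists2 f : T -> U, (forall x, A x -> B (f x)) &
    forall x y, A x -> A y -> f x = f y -> x = y.
Proof.
move=> /card_leP[f].
pose g x := if pselect (A x) is left Ax then sval (f (SigSub (mem_set Ax))) else u0.
exists g => [x Ax|x y Ax Ay]; rewrite /g; case: pselect => // Ax'.
  by apply: set_mem; exact: (svalP (f _)).
case: pselect => // Ay' /val_inj fxy.
have := 'inj_f (in_setT _) (in_setT _) fxy.
by case.
Qed.

Lemma inj_card_le_set T U (A : set T) (B : set U) (f : T -> U) :
  (forall x, A x -> B (f x)) ->
  (forall x y, A x -> A y -> f x = f y -> x = y) -> A #<= B.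
Proof.
move=> fB finj; have /injfunPex[g] : exists2 f : T -> U, set_fun A B f & set_inj A f.
  by exists f => // x y /set_mem Ax /set_mem Ay; apply: finj.
exact: inj_card_le.
Qed.

(** * Recursion, suprema and cofinality in a well-ordered type *)

Section WellOrder.
Context {d : Order.disp_t} {O : orderType d} (wo : well_ordered O).
Implicit Types (a b l k x y z : O) (P : O -> Prop) (F : O -> O).

Lemma ex_least P : (exists x, P x) -> exists2 x, P x & forall y, P y -> x <= y.
Proof.
move=> [x0 Px0]; have [|x [[xP xmin] _]] := wo (A := [pred x | `[< P x >]]).
  by exists x0; apply/asboolP.
exists x; first by move: xP => /asboolP.
by move=> y Py; apply: xmin; apply/asboolP.
Qed.

Lemma wo_ind P : (forall x, (forall y, y < x -> P y) -> P x) -> forall x, P x.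
Proof.
move=> IH x; apply: contrapT => nPx.
have [y nPy ymin] := ex_least (ex_intro (fun z => ~ P z) x nPx).
apply: nPy; apply: IH => z zy; apply: contrapT => /ymin.
by rewrite leNgt zy.
Qed.

Lemma lt_wf : well_founded (fun x y : O => is_true (x < y)).
Proof. by move=> x; elim/wo_ind: x => x IH; constructor. Qed.

Lemma wo_rec (A : Type) (A0 : A) (G : O -> (O -> A) -> A) :
  exists f : O -> A, forall x, f x = G x (fun y => if y < x then f y else A0).
Proof.
pose step x (r : forall y, y < x -> A) : A :=
  G x (fun y => match pselect (y < x) with left p => r y p | right _ => A0 end).
exists (Fix lt_wf (fun _ => A) step) => x.
rewrite Fix_eq /step; last first.
  move=> y f g fg; congr (G y); apply/funext => z.
  by case: pselect => // p; rewrite fg.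
by congr (G x); apply/funext => y; case: pselect => [->|/negP/negPf ->].
Qed.

(** A witness is chosen in advance for every pair [(x, f)] that has one, and the recursion follows
    this choice; [Q x f] depends on [f] below [x] only, so truncating [f] there is harmless. *)
Lemma wo_rec_choice (A : Type) (A0 : A) (D : set O)
    (Q : O -> (O -> A) -> A -> Prop) :
  (forall x f g v, (forall y, y < x -> f y = g y) -> Q x f v -> Q x g v) ->
  (forall x f, D x -> (forall y, y < x -> D y -> Q y f (f y)) ->
     exists v, Q x f v) ->
  exists f : O -> A, forall x, D x -> Q x f (f x).
Proof.
move=> Qext Qex.
have /choice[ch chP] : forall p : O * (O -> A), exists w,
    (exists v, Q p.1 p.2 v) -> Q p.1 p.2 w.
  move=> p; have [[v Qv]|nQ] := pselect (exists v, Q p.1 p.2 v).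
    by exists v.
  by exists A0 => /nQ.
have [f fE] := wo_rec A0 (fun x g => ch (x, g)).
exists f; elim/wo_ind => x IH Dx.
rewrite fE; set g := (fun y => _).
have fg y : y < x -> g y = f y by rewrite /g => ->.
apply: (Qext _ g) => //; apply: (chP (x, g)) => /=.
have [v Qv] := Qex x f Dx IH.
by exists v; apply: Qext Qv => y /fg ->.
Qed.

Lemma ex_bot (x0 : O) : exists x, forall y, x <= y.
Proof.
have [|x _ xmin] := @ex_least (fun=> True); first by exists x0.
by exists x => y; apply: xmin.
Qed.

Lemma ex_sup (A : set O) u : ubound A u ->
  exists2 s, is_sup A s & s <= u.
Proof.
move=> Au; have [s sP smin] := ex_least (ex_intro (ubound A) u Au).
by exists s; [split=> // y /smin | apply: smin].
Qed.

Definition no_max a := forall x, x < a -> exists2 y, x < y & y < a.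

Lemma no_max2 a x y : no_max a -> x < a -> y < a ->
  exists z, [/\ x < z, y < z & z < a].
Proof.
move=> aM xa ya; have [|z] := aM (Order.max x y); first by rewrite gt_max xa.
by rewrite gt_max => /andP[xz yz] za; exists z.
Qed.

Lemma cofinal_is_sup a (A : set O) : no_max a -> cofinal_in a A -> is_sup A a.
Proof.
move=> aM [Aa Acof]; split=> [x /Aa/ltW//|u uA].
rewrite leNgt; apply/negP => /aM[y uy /Acof[z Az yz]].
by have := uA _ Az; rewrite leNgt (lt_le_trans uy yz).
Qed.

Lemma is_sup_gt a (A : set O) x : is_sup A a -> x < a -> exists2 y, A y & x < y.
Proof.
move=> [_ amin] xa; apply: contrapT => nA.
suff : a <= x by rewrite leNgt xa.
by apply: amin => y Ay; rewrite leNgt; apply/negP => xy; apply: nA; exists y.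
Qed.

Lemma cofinal_gt a (A : set O) x : no_max a -> cofinal_in a A -> x < a ->
  exists y, [/\ A y, x < y & y < a].
Proof.
move=> aM [Aa Acof] /aM[y xy /Acof[z Az yz]].
by exists z; split=> //; [apply: lt_le_trans yz | apply: Aa].
Qed.

Lemma not_cofinal a (A : set O) : A `<=` below a -> ~ cofinal_in a A ->
  exists2 s, s < a & forall x, A x -> x < s.
Proof.
move=> Aa nA; apply: contrapT => nS; apply: nA; split=> // x xa.
apply: contrapT => nx; apply: nS; exists x => // y Ay.
by rewrite ltNge; apply/negP => xy; apply: nx; exists y.
Qed.

(** Otherwise [F] would give a cofinal map from an ordinal below the cofinality of [a]. *)
Lemma cf_bound a l j F : is_cf a l -> j < l -> (forall x, x < j -> F x < a) ->
  exists2 s, s < a & forall x, x < j -> F x < s.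
Proof.
move=> [_ acf] jl Fa.
pose f (x : seg j) : seg a := exist _ (F (sval x)) (Fa _ (svalP x)).
have /not_cofinal[|s sa sP] : ~ cofinal_in a [set sval (f x) | x in [set: seg j]].
  by move=> fcof; apply: (acf j jl); exists f.
  by move=> _ [x _ <-] /=; apply: Fa (svalP x).
by exists s => // x xj; apply: sP; exists (exist _ x xj).
Qed.

Lemma cf_bound2 a l i j (F : O -> O -> O) : is_cf a l -> i < l -> j < l ->
  (forall x y, x < i -> y < j -> F x y < a) ->
  exists2 s, s < a & forall x y, x < i -> y < j -> F x y < s.
Proof.
move=> acf il jl Fa.
have /choice[G GP] :
  (forall x, exists s, x < i -> s < a /\ forall y, y < j -> F x y < s).
  move=> x; have [xi|] := boolP (x < i); last by exists x.
  have [s sa sP] := cf_bound acf jl (fun y => Fa x y xi).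
  by exists s => _; split.
have [|s sa sP] := @cf_bound a l i G acf il; first by move=> x /GP[].
by exists s => // x y xi yj; apply: lt_trans (sP _ xi); apply: (GP x xi).2.
Qed.

Lemma cf_no_max a l : is_cf a l -> (exists x y, [/\ x < y & y < l]) ->
  no_max a.
Proof.
move=> acf [z [y [zy yl]]] x xa; apply: contrapT => nx.
have [s sa sP] := cf_bound (F := fun=> x) acf yl (fun _ _ => xa).
by apply: nx; exists s => //; apply: sP zy.
Qed.

Lemma regular_gt1 a : regular_cardinal a -> exists x y, [/\ x < y & y < a].
Proof.
move=> [[_ ainf] _]; apply: contrapT => nxy.
have [x xa] := infinite_setN0 ainf.
apply: ainf; apply: (@sub_finite_set _ _ [set x]); last exact: finite_set1.
move=> y ya; apply/eqP; case: ltgtP => // xy; case: nxy.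
  by exists y, x.
by exists x, y.
Qed.

Lemma regular_no_max a : regular_cardinal a -> no_max a.
Proof. by move=> areg; apply: (cf_no_max areg.2 (regular_gt1 areg)). Qed.

(** [below a] contains a copy of [nat]; carried over to it, the sequence becomes a function on
    [a < k], which regularity bounds. *)
Lemma regular_countable_bound a k (u : nat -> O) : infinite_set (below a) ->
  is_cf k k -> a < k -> (forall n, u n < k) -> exists2 s, s < k & forall n, u n < s.
Proof.
move=> /infiniteP ainf kcf ak uk.
have [q qa qinj] := card_le_inj a ainf.
have /choice[F FP] : forall x, exists y, (x < k -> y < k) /\ forall n, x = q n -> y = u n.
  move=> x; have [[n xn]|nx] := pselect (exists n, x = q n).
    exists (u n); split=> // m; rewrite xn => /qinj -> //.
  by exists x; split=> // n xn; case: nx; exists n.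
have [x xa|s sk sP] := cf_bound (F := F) kcf ak.
  by apply: (FP x).1; apply: lt_trans ak.
exists s => // n; rewrite -((FP (q n)).2 n erefl); apply: sP; exact: qa.
Qed.

End WellOrder.

(** * Bookkeeping functions, closure points and Fodor's lemma *)

Section Bookkeeping.
Context {d : Order.disp_t} {O : orderType d} (wo : well_ordered O).
Implicit Types (a b l k x y z i j : O) (F f g h : O -> O).

(* [h x] is an index [i] for which the maximum of [i] and of the last time
   before [x] at which [i] was used is least possible. *)
Lemma ex_cofinal_fibers l : regular_cardinal l ->
  exists2 h : O -> O, (forall x, x < l -> h x < l) &
    forall i x, i < l -> x < l -> exists y, [/\ x <= y, y < l & h y = i].
Proof.
move=> lreg; have lM := regular_no_max lreg; have lcf := lreg.2.
pose low f x i z := i <= z /\ forall y, y < x -> f y = i -> y < z.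
pose Q x f i := i < l /\ forall i' z, i' < l -> low f x i' z -> low f x i z.
have [x0 [x1 [x01 x1l]]] := regular_gt1 lreg.
have [|x f xl _|h hP] := @wo_rec_choice _ _ wo _ x0 (below l) Q.
- move=> x f g i fg [il iP]; split=> // i' z i'l [i'z lowi'].
  have [|iz lowi] := iP i' z i'l; first by split=> // y yx; rewrite fg//; apply: lowi'.
  by split=> // y yx; rewrite -fg//; apply: lowi.
- have [|z [i il lowi] zmin] := @ex_least _ _ wo (fun z => exists2 i, i < l & low f x i z).
    exists (Order.max x0 x), x0; first exact: lt_trans x1l.
    by split=> [|y yx _]; rewrite ?le_max ?lexx ?lt_max ?yx ?orbT.
  exists i; split=> // i' z' i'l lowi'.
  have zz' : z <= z' by apply: zmin; exists i'.
  split; first by apply: le_trans zz'; exact: lowi.1.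
  by move=> y yx fy; apply: lt_le_trans zz'; apply: lowi.2 fy.
exists h => [x /hP[]//|i x il xl]; apply: contrapT => nfib.
pose z0 := Order.max i x.
have z0l : z0 < l by rewrite gt_max il.
have lowz y : z0 <= y -> y < l -> low h y (h y) z0.
  move=> z0y yl; apply: (hP y yl).2 il _; split=> [|y' y'y hy'].
    by rewrite le_max lexx.
  rewrite lt_max; apply/orP; right; rewrite ltNge; apply/negP => xy'.
  by apply: nfib; exists y'; split=> //; apply: lt_trans yl.
have [z1 z01 z1l] := lM _ z0l.
have /choice[F FP] : forall i', exists y, y < l /\
    forall y', z0 <= y' -> y' < l -> h y' = i' -> [/\ z0 <= y & h y = i'].
  move=> i'; have [[y [zy yl hy]]|nh] :=
    pselect (exists y, [/\ z0 <= y, y < l & h y = i']).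
    by exists y.
  by exists x; split=> // y' zy' y'l hy'; case: nh; exists y'.
have [i' _|s sl sP] := cf_bound (F := F) lcf z1l; first by case: (FP i').
pose y := Order.max s z0.
have yl : y < l by rewrite gt_max sl.
have z0y : z0 <= y by rewrite le_max lexx orbT.
have [z0F hF] := (FP (h y)).2 y z0y yl erefl.
have := sP (h y) (le_lt_trans (lowz _ z0y yl).1 z01).
have [Fl _] := FP (h y).
have [yF|Fy|<-] := ltgtP y (F (h y)).
- have := (lowz _ z0F Fl).2 y yF; rewrite hF => /(_ erefl).
  by rewrite ltNge z0y.
- have := (lowz _ z0y yl).2 _ Fy hF.
  by rewrite ltNge z0F.
- by rewrite ltNge le_max lexx.
Qed.

(* [e] climbs as long as it stays bounded on a left neighbourhood, so on a set
   of cofinality [l] it cannot stay bounded below [l]. *)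
Lemma ex_unbounded_tails l : regular_cardinal l ->
  exists2 e : O -> O, (forall b, e b < l) &
    forall a x i, is_cf a l -> x < a -> i < l ->
      exists y, [/\ x <= y, y < a & i <= e y].
Proof.
move=> lreg; have [x0 [x1 [x01 x1l]]] := regular_gt1 lreg.
pose tail b f v := exists2 x, x < b & forall y, x <= y -> y < b -> f y < v.
pose Q b f v := v < l /\ ((exists2 i, i < l & tail b f i) -> tail b f v).
have tailE b f g v : (forall y, y < b -> f y = g y) -> tail b f v -> tail b g v.
  by move=> fg [x xb xP]; exists x => // y xy yb; rewrite -fg//; apply: xP.
have [|x f _ _|e eP] := @wo_rec_choice _ _ wo _ x0 setT Q.
- move=> x f g v fg [vl vP]; split=> // -[i il gi]; apply: (tailE _ f) => //.
  by apply: vP; exists i => //; apply: (tailE _ g) => // y /fg ->.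
- have [[i il fi]|nt] := pselect (exists2 i, i < l & tail x f i).
    by exists i.
  by exists x0; split=> //; apply: lt_trans x1l.
exists e => [b|a x i acf xa il]; first by case: (eP b).
apply: contrapT => nb.
have eb y : x <= y -> y < a -> e y < i.
  by move=> xy ya; rewrite ltNge; apply/negP => iy; apply: nb; exists y.
(* As [e] is bounded before [z], the value [e z] is itself a bound from some [u < z] on; points
   before [u] are compared through [e u]. So [e] is injective on a tail of [a], with values below
   [i < l], and its inverse would be cofinal in [a]. *)
have emono z : forall y, x <= y -> y < z -> z < a -> e y < e z.
  elim/(wo_ind wo): z => z IH y xy yz za.
  have [//||u uz uP] := (eP z _).2.
    exists i => //; exists x; first exact: le_lt_trans yz.
    by move=> w xw wz; apply: eb => //; apply: lt_trans za.
  have [uy|yu] := leP u y; first exact: uP.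
  apply: (lt_trans (IH u uz y xy yu (lt_trans uz za))).
  by apply: uP.
have /choice[F FP] : forall v, exists w, w < a /\
    forall y, x <= y -> y < a -> e y = v -> w = y.
  move=> v; have [[y [xy ya eyv]]|ny] := pselect (exists y, [/\ x <= y, y < a & e y = v]).
    exists y; split=> // y' xy' y'a ey'v.
    case: (ltgtP y y') => // [yy'|y'y].
      by have := emono _ _ xy yy' y'a; rewrite eyv ey'v ltxx.
    by have := emono _ _ xy' y'y ya; rewrite eyv ey'v ltxx.
  by exists x; split=> // y xy ya eyv; case: ny; exists y.
have [v _|s sa sP] := cf_bound (F := F) acf il; first by case: (FP v).
have ya : Order.max s x < a by rewrite gt_max sa.
have xy : x <= Order.max s x by rewrite le_max lexx orbT.
have := sP _ (eb _ xy ya).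
by rewrite ((FP _).2 _ xy ya erefl) ltNge le_max lexx.
Qed.

(** New elements of [X] are listed as long as there are any: this lasts for [l] stages, or [X] is
    exhausted at some stage [m < l]. *)
Lemma ex_enumeration T (t0 : T) (X : set T) l :
  (exists f : O -> T, (forall x, x < l -> X (f x)) /\
     forall x y, x < l -> y < l -> f x = f y -> x = y) \/
  (exists m (f : O -> T), m < l /\ forall t, X t -> exists2 x, x < m & f x = t).
Proof.
pose new x (f : O -> T) v := X v /\ forall y, y < x -> f y <> v.
pose Q x (f : O -> T) v := (exists w, new x f w) -> new x f v.
have [|x f _ _|f fP] := @wo_rec_choice _ _ wo _ t0 setT Q.
- move=> x f g v fg Qv [w [Xw gw]].
  have [|Xv fv] := Qv; first by exists w; split=> // y yx; rewrite fg//; apply: gw.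
  by split=> // y yx; rewrite -fg//; apply: fv.
- have [[w wP]|nw] := pselect (exists w, new x f w); first by exists w.
  by exists t0.
have [[m [ml nm]]|nex] := pselect (exists m, m < l /\ ~ exists w, new m f w).
  right; exists m, f; split=> // t Xt; apply: contrapT => nt; apply: nm.
  by exists t; split=> // y ym fy; apply: nt; exists y.
left; exists f; have fnew x : x < l -> new x f (f x).
  move=> xl; apply: fP => //; apply: contrapT => nw; apply: nex.
  by exists x.
split=> [x /fnew[]//|x y xl yl fxy].
case: (ltgtP x y) => // [xy|yx].
  by have [_ /(_ x xy)] := fnew y yl; rewrite fxy.
by have [_ /(_ y yx)] := fnew x xl; rewrite fxy.
Qed.

Definition closed_under F a := forall x, x < a -> F x < a.

(** Stationarity tested on sets of closure points of functions, the form convenient for pressing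
    down and guessing. *)
Definition hits_closed k (S : set O) :=
  forall F, closed_under F k -> exists2 a, S a & closed_under F a.

Section Closure.
Variables (l k : O).
Hypotheses (l_inf : infinite_set (below l)) (lk : l < k).
Hypothesis k_reg : regular_cardinal k.

Lemma club_closed_under F : closed_under F k ->
  club k [set a | a < k /\ closed_under F a].
Proof.
move=> Fk; have kM := regular_no_max k_reg; split.
  split=> [a []//|x xk].
  have /choice[G GP] : forall y, exists z, y < k ->
      [/\ z < k, y < z & forall w, w <= y -> F w < z].
    move=> y; have [yk|] := boolP (y < k); last by exists y.
    have [y1 yy1 y1k] := kM _ yk.
    have [w wy1|s sk sP] := cf_bound (F := F) k_reg.2 y1k.
      by apply: Fk; apply: lt_trans y1k.
    exists (Order.max s y1) => _; split; first by rewrite gt_max sk.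
      by rewrite lt_max yy1 orbT.
    by move=> w wy; rewrite lt_max sP// (le_lt_trans wy).
  (* [G] dominates [F] on initial segments, so the supremum of its iterates is a closure point; it
     is below [k] because [k] is regular and has the infinite [l] below it. *)
  pose u n := iter n G x.
  have uk n : u n < k by elim: n => // n /GP[].
  have [s sk sP] := regular_countable_bound l_inf k_reg.2 lk uk.
  have [|a aP as_] := @ex_sup _ _ wo (range u) s; first by move=> _ [n _ <-]; apply/ltW.
  have ua n : u n < a.
    apply: (@lt_le_trans _ _ (u n.+1)); first by have [] := GP _ (uk n).
    by apply: aP.1; exists n.+1.
  exists a; last exact/ltW/(ua 0%N).
  split; first exact: le_lt_trans as_ sk.
  move=> y /(is_sup_gt aP)[_ [n _ <-] yn].
  apply: lt_trans (ua n.+1); have [_ _] := GP _ (uk n); apply; exact: ltW.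
move=> b bk blim bsup; split=> // x xb.
have [y [[yk yF] yb] xy] := is_sup_gt bsup xb.
by apply: lt_trans yb; apply: yF.
Qed.

Lemma stationary_hits_closed S : stationary k S -> hits_closed k S.
Proof.
move=> [_ Sstat] F /club_closed_under /Sstat[a [Sa [_ aF]]].
by exists a.
Qed.

(** If [F] sends [x] to a point of the club above [x], a limit ordinal closed under [F] is a limit
    of the club. *)
Lemma hits_closed_stationary S : S `<=` below k ->
  (forall a, S a -> limit_ordinal a) -> hits_closed k S -> stationary k S.
Proof.
move=> Sk Slim Shit; split=> // C [Ccof Cclosed].
have kM := regular_no_max k_reg.
have /choice[F FP] : forall x, exists y, x < k -> [/\ C y, x < y & y < k].
  move=> x; have [xk|] := boolP (x < k); last by exists x.
  by have [y yP] := cofinal_gt kM Ccof xk; exists y.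
have [|a Sa aF] := Shit F; first by move=> x /FP[].
exists a; split=> //; apply: Cclosed; [exact: Sk|exact: Slim|].
split=> [x [_ /ltW]//|u ub]; rewrite leNgt; apply/negP => ua.
have uk := lt_trans ua (Sk _ Sa); have [CF uF _] := FP u uk.
have := ub (F u) (conj CF (aF _ ua)).
by rewrite leNgt uF.
Qed.

(** Diagonal intersection: if [G v] refutes the fiber over [v] for every [v], a point [a] closed
    under [G v] for all [v < a] is closed under [G (F a)], a contradiction. *)
Lemma fodor S F : hits_closed k S -> S `<=` below k -> (forall a, S a -> F a < a) ->
  exists2 v, v < k & hits_closed k [set a | S a /\ F a = v].
Proof.
move=> Shit Sk Freg; apply: contrapT => nv.
have kM := regular_no_max k_reg.
have /choice[G GP] : forall v, exists g, v < k ->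
    closed_under g k /\ forall a, S a -> F a = v -> ~ closed_under g a.
  move=> v; have [vk|] := boolP (v < k); last by exists id.
  apply: contrapT => ng; apply: nv; exists v => // g gk.
  apply: contrapT => na; apply: ng; exists g => _; split=> // a Sa Fa ga.
  by apply: na; exists a.
have /choice[H HP] : forall x, exists s, x < k ->
    s < k /\ forall v z, v <= x -> z <= x -> G v z < s.
  move=> x; have [xk|] := boolP (x < k); last by exists x.
  have [y xy yk] := kM _ xk.
  have [v z vy zy|s sk sP] := cf_bound2 (F := G) k_reg.2 yk yk.
    by apply: (GP v (lt_trans vy yk)).1; apply: lt_trans yk.
  by exists s => _; split=> // v z vx zx; apply: sP; apply: le_lt_trans xy.
have [x /HP[]//|a Sa aH] := Shit H.
have Faa := Freg _ Sa; have ak := Sk _ Sa.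
apply: ((GP (F a) (lt_trans Faa ak)).2 a Sa erefl) => z za.
have ma : Order.max (F a) z < a by rewrite gt_max Faa.
apply: lt_trans (aH _ ma).
by apply: (HP _ (lt_trans ma ak)).2; rewrite le_max lexx ?orbT.
Qed.

End Closure.
End Bookkeeping.

(** * Ladders, non-accumulating cofinal sets and stationary guessing *)

Section Ladders.
Context {d : Order.disp_t} {O : orderType d} (wo : well_ordered O).
Implicit Types (a b x y z i j dl : O) (F f g h : O -> O) (S Z : set O).

Lemma cofinal_map_total a b : cofinal_map a b -> exists2 F : O -> O,
  (forall x, x < b -> F x < a) & forall y, y < a -> exists2 x, x < b & y <= F x.
Proof.
move=> [f [_ fcof]].
pose F x := if pselect (x < b) is left xb then sval (f (exist _ x xb)) else x.
exists F => [x xb|y /fcof[_ [x _ <-] yx]].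
  by rewrite /F; case: pselect => // xb'; exact: (svalP (f _)).
exists (sval x); first exact: (svalP x).
rewrite /F; case: pselect => [xb|/(_ (svalP x))//].
suff -> : exist _ (sval x) xb = x by [].
by case: x {yx} xb => x xb xb' /=; congr exist; apply: bool_irrelevance.
Qed.

Lemma cofinal_map_refl a : cofinal_map a a.
Proof.
exists id; split=> [_ [x _ <-]|x xa]; first exact: (svalP x).
by exists x => //; exists (exist _ x xa).
Qed.

Lemma ex_cf a : exists b, is_cf a b.
Proof.
have [b bP bmin] := ex_least wo (ex_intro (cofinal_map a) a (cofinal_map_refl a)).
by exists b; split=> // x xb /bmin; rewrite leNgt xb.
Qed.

(** For uncountable cofinality nonreflection gives a club of [a] avoiding [Z], which cannot
    accumulate at a point of [Z]; for countable cofinality a cofinal set of order type at most omega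
    does not accumulate below [a]. *)
Lemma ex_separated k Z a : (forall dl, Z dl -> limit_ordinal dl) ->
  nonreflecting k Z -> a < k ->
  exists2 E, cofinal_in a E & forall dl, Z dl -> dl < a ->
    exists2 x, x < dl & forall y, E y -> x <= y -> dl <= y.
Proof.
move=> Zlim Znr ak; have [ucf|nucf] := pselect (uncountable_cf a).
  have [C Cclub CZ] : exists2 C, club a C & forall x, C x -> x < a -> ~ Z x.
    apply: contrapT => nC; apply: Znr; exists a; split=> //; split=> [x []//|C Cclub].
    apply: contrapT => CZ0; apply: nC; exists C => // x Cx xa Zx.
    by apply: CZ0; exists x.
  exists C; first exact: Cclub.1.
  move=> dl Zdl dla; apply: contrapT => nx; apply: (CZ dl) => //.
  apply: Cclub.2 => //; first exact: Zlim.
  split=> [x [_ /ltW]//|u ub]; rewrite leNgt; apply/negP => udl.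
  have [x ux xdl] := (Zlim _ Zdl).2 u udl.
  apply: nx; exists x => // y Cy xy; rewrite leNgt; apply/negP => ydl.
  by have := ub y (conj Cy ydl); rewrite leNgt (lt_le_trans ux xy).
have [b bcf] := ex_cf a.
have bcount : countable (below b).
  by apply: contrapT => nb; apply: nucf; exists b.
have [q _ qinj] := card_le_inj 0%N bcount.
have [F Fa Fcof] := cofinal_map_total bcf.1.
(* The values exceeding all those enumerated before them: such a value below [dl] is enumerated no
   later than any given value not below [dl], so there are finitely many. *)
pose E y := exists z, [/\ z < b, F z = y &
  forall z', z' < b -> (q z' < q z)%N -> F z' < F z].
exists E.
  split=> [_ [z [zb <- _]]|x xa]; first exact: Fa.
  have exn : exists n, `[< exists z, [/\ z < b, x <= F z & q z = n] >].
    by have [z zb xz] := Fcof x xa; exists (q z); apply/asboolP; exists z.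
  case: (ex_minnP exn) => n /asboolP[z [zb xz qz]] nmin.
  exists (F z) => //; exists z; split=> // z' z'b.
  rewrite qz => qz'; apply: lt_le_trans xz; rewrite ltNge; apply/negP => xz'.
  have /nmin : `[< exists w, [/\ w < b, x <= F w & q w = q z'] >].
    by apply/asboolP; exists z'.
  by rewrite leqNgt qz'.
move=> dl Zdl dla; have [z0 z0b dlz0] := Fcof dl dla.
have fin n : exists2 x, x < dl & forall z, z < b -> (q z < n)%N -> F z < dl -> F z < x.
  elim: n => [|n [x xdl xP]].
    by have [[x xdl] _] := Zlim _ Zdl; exists x.
  have [[z [zb qz zdl]]|nz] := pselect (exists z, [/\ z < b, q z = n & F z < dl]).
    have [x' [xx' zx' x'dl]] := no_max2 (Zlim _ Zdl).2 xdl zdl.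
    exists x' => // w wb; rewrite ltnS leq_eqVlt => /orP[/eqP qw|qw] wdl.
      by rewrite (qinj _ _ wb zb _) ?qw ?qz.
    by apply: lt_trans xx'; apply: xP.
  exists x => // w wb; rewrite ltnS leq_eqVlt => /orP[/eqP qw|qw] wdl.
    by case: nz; exists w.
  exact: xP.
have [x xdl xP] := fin (q z0).+1.
exists x => // _ [z [zb <- zrec]] xz; rewrite leNgt; apply/negP => zdl.
have [qz0|qz] := ltnP (q z0) (q z).
  by have := zrec _ z0b qz0; rewrite ltNge (le_trans (ltW zdl) dlz0).
by have := xP z zb qz zdl; rewrite ltNge xz.
Qed.

(** At stage [j] the earlier points are bounded in [a], as [j] is below its cofinality, and [e]
    reaches [j] beyond this bound and beyond [F j]. *)
Lemma ex_ladder l e a :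
  (forall a x i, is_cf a l -> x < a -> i < l ->
     exists y, [/\ x <= y, y < a & i <= e y]) ->
  is_cf a l ->
  exists g : O -> O, [/\ forall j, j < l -> g j < a,
    forall i j, i < j -> j < l -> g i < g j,
    forall x, x < a -> exists2 j, j < l & x <= g j &
    forall j, j < l -> j <= e (g j)].
Proof.
move=> eP acf; have [F Fa Fcof] := cofinal_map_total acf.1.
pose Q j g v := [/\ v < a, F j <= v, j <= e v & forall i, i < j -> g i < v].
have [|j g jl IH|g gP] := @wo_rec_choice _ _ wo _ l (below l) Q.
- by move=> j f g v fg [va Fv ev fv]; split=> // i ij; rewrite -fg//; apply: fv.
- have [i ij|s sa sP] := cf_bound (F := g) acf jl.
    by have [] := IH i ij (lt_trans ij jl).
  have xa : Order.max s (F j) < a by rewrite gt_max sa Fa.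
  have [y []] := eP a _ j acf xa jl.
  rewrite ge_max => /andP[sy Fy] ya jy; exists y; split=> // i ij.
  by apply: lt_le_trans sy; apply: sP.
exists g; split=> [j /gP[]//|i j ij /gP[_ _ _]|x /Fcof[j jl xj]|j /gP[]//].
  exact.
by exists j => //; apply: le_trans xj _; have [] := gP _ jl.
Qed.

(** [rho b] is the least [j] with [b <= g j]. It is constant near a point [dl] of cofinality [l],
    because the fewer than [l] ladder points below [dl] are bounded in [dl]. *)
Lemma ex_rank l a g : (forall j, j < l -> g j < a) ->
  (forall i j, i < j -> j < l -> g i < g j) ->
  (forall x, x < a -> exists2 j, j < l & x <= g j) ->
  exists rho : O -> O, [/\ forall b, b < a -> rho b < l,
    forall b j, b < a -> j < l -> g j < b -> j < rho b,
    forall dl, is_cf dl l -> dl < a ->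
      exists2 x, x < dl & exists2 j, j < l & forall b, x <= b -> b < dl -> rho b = j &
    forall j, j < l -> rho (g j) = j].
Proof.
move=> ga gmono gcof.
have /choice[rho rhoP] : forall b, exists j, b < a ->
    [/\ j < l, b <= g j & forall i, i < j -> g i < b].
  move=> b; have [ba|] := boolP (b < a); last by exists b.
  have [|j [jl bj] jmin] := @ex_least _ _ wo (fun j => j < l /\ b <= g j).
    by have [j jl bj] := gcof b ba; exists j.
  exists j => _; split=> // i ij; rewrite ltNge; apply/negP => bi.
  by have := jmin i (conj (lt_trans ij jl) bi); rewrite leNgt ij.
have rhoU b j : b < a -> j < l -> b <= g j -> (forall i, i < j -> g i < b) -> rho b = j.
  move=> ba jl bj ltb; have [rl brho rltb] := rhoP b ba.
  case: (ltgtP (rho b) j) => // [/ltb|/rltb] => [|]; first by rewrite ltNge brho.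
  by rewrite ltNge bj.
exists rho; split=> [b /rhoP[]//|b j ba jl jb|dl dlcf dla|j jl].
- have [rl brho _] := rhoP b ba; rewrite ltNge; apply/negP.
  rewrite le_eqVlt => /orP[/eqP rj|/gmono/(_ jl) rj].
    by move: brho; rewrite rj leNgt jb.
  by move: (lt_trans rj jb); rewrite ltNge brho.
- have [jl dlj jlt] := rhoP dl dla; set j := rho dl in jl dlj jlt.
  have [x xdl xP] := cf_bound dlcf jl jlt.
  exists x => //; exists j => // b xb bdl; apply: rhoU => //.
  + exact: lt_trans dla.
  + by apply: le_trans dlj; apply: ltW.
  + by move=> i ij; apply: lt_le_trans xb; apply: xP.
- by apply: rhoU => //; [apply: ga|move=> i ij; apply: gmono].
Qed.

(* Solovay's splitting: for some [j] the points [g a j] are unbounded in [k] on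
   every closed unbounded set, and Fodor's lemma gives [k] many stationary
   fibers of [a |-> g a j]. *)
Lemma ex_stationary_guess l k S (g : O -> O -> O) (Sg : Type) (s0 : Sg) :
  infinite_set (below l) -> l < k -> regular_cardinal k ->
  stationary k S -> (forall a, S a -> limit_ordinal a) ->
  (forall a j, S a -> j < l -> g a j < a) ->
  (forall a x, S a -> x < a -> exists2 j, j < l & x <= g a j) ->
  [set: Sg] #<= below k ->
  exists s : O -> Sg, forall t, hits_closed k [set a | S a /\ s a = t].
Proof.
move=> linf lk kreg Sstat Slim ga gcof Sgk; have kM := regular_no_max kreg.
have Shit := stationary_hits_closed wo linf lk kreg Sstat.
have [j jl jP] : exists2 j, j < l & forall x, x < k ->
    hits_closed k [set a | S a /\ x <= g a j].
  apply: contrapT => nj.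
  (* If every [j] failed, with bound [p.1] and function [p.2], a point of [S] closed under all these
     functions and above all these bounds would have no ladder point beyond the bounds. *)
  have /choice[p pP] : forall j, exists p : O * (O -> O), j < l ->
      [/\ p.1 < k, closed_under p.2 k &
       forall a, S a -> p.1 <= g a j -> ~ closed_under p.2 a].
    move=> j; have [jl|] := boolP (j < l); last by exists (j, id).
    apply: contrapT => np; apply: nj; exists j => // x xk F Fk.
    apply: contrapT => na; apply: np; exists (x, F) => _; split=> // a Sa xa Fa.
    by apply: na; exists a.
  have [j /pP[]//|s sk sP] := cf_bound (F := fun j => (p j).1) kreg.2 lk.
  have /choice[G GP] : forall x, exists y, x < k ->
      [/\ y < k, s <= y & forall j, j < l -> (p j).2 x < y].
    move=> x; have [xk|] := boolP (x < k); last by exists x.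
    have [j /pP[_ + _]|y yk yP] := cf_bound (F := fun j => (p j).2 x) kreg.2 lk.
      exact.
    exists (Order.max s y) => _; split=> [||j jl]; rewrite ?gt_max ?sk ?le_max ?lexx//.
    by rewrite lt_max yP ?orbT.
  have [x /GP[]//|a Sa aG] := Shit G.
  have ak : a < k by apply: Sstat.1.
  have [[x xa] _] := Slim _ Sa.
  have sa : s < a.
    by apply: le_lt_trans (aG x xa); have [] := GP x (lt_trans xa ak).
  have [j jl sj] := gcof a s Sa sa.
  have [_ _ /(_ a Sa (le_trans (ltW (sP _ jl)) sj))] := pP j jl; apply => y ya.
  apply: lt_trans (aG y ya); have [_ _] := GP y (lt_trans ya ak); exact.
pose V := [set v | v < k /\ hits_closed k [set a | S a /\ g a j = v]].
have Vcof x : x < k -> exists2 v, V v & x <= v.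
  move=> xk; have hx := jP x xk.
  have [a []|a [Sa _]|v vk vhit] := fodor kreg hx (F := fun a => g a j).
  - by move=> /Sstat.1.
  - exact: ga.
  exists v; first by split=> // F /vhit[a [[Sa _] gv] aF]; exists a.
  have [a [[_ xa] <-] _] := vhit id (fun _ => id).
  exact: xa.
(* Regularity forbids listing the cofinal set [V] by some [m < k]; so [V] contains a copy of [k], to
   whose members the elements of [Sg] are attached. *)
have [[f [fV finj]]|[m [f [mk fsur]]]] := ex_enumeration wo k V k; last first.
  pose F x := if f x < k then f x else m.
  have [x _|s sk sP] := cf_bound (F := F) kreg.2 mk.
    by rewrite /F; case: ifP.
  have [v Vv sv] := Vcof s sk; have [x xm fx] := fsur v Vv.
  by have := sP x xm; rewrite /F fx Vv.1 ltNge sv.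
have [io iok ioinj] := card_le_inj k Sgk.
have /choice[s sP] : forall a, exists t, forall t', f (io t') = g a j -> t = t'.
  move=> a; have [[t tP]|nt] := pselect (exists t, f (io t) = g a j).
    exists t => t'; rewrite -tP => /finj E; apply: ioinj => //.
    by rewrite E//; apply: iok.
  by exists s0 => t' t'P; case: nt; exists t'.
exists s => t F Fk.
have [_ /(_ F Fk)[a [Sa gaf] aF]] := fV (io t) (iok t I).
by exists a => //; split=> //; apply: sP.
Qed.

End Ladders.

(** * Levels attached to walks *)

Section Levels.
Context {d : Order.disp_t} {O : orderType d} (wo : well_ordered O).
Implicit Types (a b x y z i j dl : O).

(* [m a b] is the largest value of [hm] at the points of [Z] met on the walk
   from [a] to [b] along the sets [E]. *)
Lemma ex_levels l k (Z : set O) (E : O -> set O) (hm : O -> O) :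
  (exists x, x < l) -> (forall a, Z a -> hm a < l) ->
  (forall a, a < k -> cofinal_in a (E a) /\ forall dl, Z dl -> dl < a ->
    exists2 x, x < dl & forall y, E a y -> x <= y -> dl <= y) ->
  exists m : O -> O -> O,
  [/\ forall a b, a < k -> m a b < l,
      forall a dl, a < k -> Z dl -> dl < a ->
        exists2 x, x < dl & forall b, x <= b -> b < dl -> hm dl <= m a b &
      forall a dl, a < k -> Z dl -> dl < a ->
        exists2 x, x < dl & exists2 u, u < l &
          forall b, x <= b -> b < dl -> m a b <= Order.max (m dl b) u].
Proof.
move=> [x0 x0l] hml EP.
have /choice[nx nxP] : forall p : O * O, exists y, p.1 < k -> p.2 < p.1 ->
    [/\ E p.1 y, p.2 <= y & forall y', E p.1 y' -> p.2 <= y' -> y <= y'].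
  move=> [a b] /=; have [ak|] := boolP (a < k); last by exists a.
  have [ba|] := boolP (b < a); last by exists a.
  have [|y [Ey yb] ymin] := @ex_least _ _ wo (fun y => E a y /\ b <= y).
    by have [y Ey yb] := (EP a ak).1.2 b ba; exists y.
  by exists y => _ _; split=> // y' Ey' by'; apply: ymin.
(* The walk steps from [a] to the least point of [E a] not below [b]; [x0] is the value once it has
   reached [b]. *)
pose G a (m : O -> O -> O) b := if (a < k) && (b < a) then
  (if pselect (Z (nx (a, b))) then Order.max (m (nx (a, b)) b) (hm (nx (a, b)))
   else m (nx (a, b)) b) else x0.
have [m mE] := wo_rec wo (fun=> x0) G.
have nxa a b : a < k -> b < a -> nx (a, b) < a.
  by move=> ak ba; have [/= Ey _ _] := nxP (a, b) ak ba; exact: (EP a ak).1.1.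
have mE' a b : a < k -> b < a -> m a b =
    if pselect (Z (nx (a, b))) then Order.max (m (nx (a, b)) b) (hm (nx (a, b)))
    else m (nx (a, b)) b.
  by move=> ak ba; rewrite mE /G ak ba /= nxa.
(* [E a] does not accumulate at [dl], so all [b] below and close to [dl] have the same first step as
   [dl]. *)
have nxE a dl : a < k -> Z dl -> dl < a -> exists y, [/\ dl <= y, y < a &
    exists2 x, x < dl & forall b, x <= b -> b < dl -> nx (a, b) = y].
  move=> ak Zdl dla; have [x xdl xP] := (EP a ak).2 dl Zdl dla.
  have [Ey dly ymin] := nxP (a, dl) ak dla.
  exists (nx (a, dl)); split=> //; first exact: nxa.
  exists x => // b xb bdl; have ba := lt_trans bdl dla.
  have [/= Ey' by' y'min] := nxP (a, b) ak ba.
  apply/eqP; rewrite eq_le y'min ?ymin //.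
    by apply: xP => //; apply: le_trans by'.
  by apply: le_trans dly; apply: ltW.
exists m; split.
- elim/(wo_ind wo) => a IH b ak; rewrite mE /G; case: ifP => // /andP[_ ba].
  have ya := nxa _ _ ak ba; have yk := lt_trans ya ak.
  by case: pselect => [Zy|?]; rewrite ?gt_max ya IH ?hml.
- elim/(wo_ind wo) => a IH dl ak Zdl dla.
  have [y [dly ya [x xdl xP]]] := nxE a dl ak Zdl dla.
  move: dly; rewrite le_eqVlt => /orP[/eqP dly|dly].
    exists x => // b xb bdl; rewrite mE' ?(lt_trans bdl)// xP// -dly.
    by case: pselect => // ?; rewrite le_max lexx orbT.
  have [x' x'dl x'P] := IH y ya dl (lt_trans ya ak) Zdl dly.
  exists (Order.max x x'); first by rewrite gt_max xdl.
  move=> b; rewrite ge_max => /andP[xb x'b] bdl.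
  rewrite mE' ?(lt_trans bdl)// xP//.
  by case: pselect => ?; rewrite ?le_max x'P.
- elim/(wo_ind wo) => a IH dl ak Zdl dla.
  have [y [dly ya [x xdl xP]]] := nxE a dl ak Zdl dla.
  move: dly; rewrite le_eqVlt => /orP[/eqP dly|dly].
    exists x => //; exists (hm dl); first exact: hml.
    move=> b xb bdl; rewrite mE' ?(lt_trans bdl)// xP// -dly.
    by case: pselect.
  have [x' x'dl [u ul uP]] := IH y ya dl (lt_trans ya ak) Zdl dly.
  exists (Order.max x x'); first by rewrite gt_max xdl.
  have [Zy|nZy] := pselect (Z y).
    exists (Order.max u (hm y)); first by rewrite gt_max ul hml.
    move=> b; rewrite ge_max => /andP[xb x'b] bdl.
    rewrite mE' ?(lt_trans bdl)// xP//; case: pselect => // ?.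
    by rewrite maxA ge_max !le_max lexx orbT andbT -le_max uP.
  exists u => // b; rewrite ge_max => /andP[xb x'b] bdl.
  by rewrite mE' ?(lt_trans bdl)// xP//; case: pselect => // ?; apply: uP.
Qed.

End Levels.

(** * Consequences of strong unboundedness *)

Section Coloring.
Context {d : Order.disp_t} {O : orderType d} (wo : well_ordered O).
Implicit Types (a b g x y z i j t dl : O) (B : set O).
Variables (l k : O) (c : O -> O -> O).
Hypotheses (l_reg : regular_cardinal l) (k_reg : regular_cardinal k) (lk : l < k).
Hypothesis c_lt : forall z b, z < l -> b < k -> c z b < l.

(** Nodes of level [z] are treated as classes of this relation, so that a node is given by any point
    through it. *)
Definition agree z b b' := forall y, y < z -> c y b = c y b'.

Hypothesis c_unb : forall B, cofinal_in k B -> exists z g0, [/\ z < l, B g0 &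
  forall v, v < l -> exists g, [/\ B g, agree z g0 g & v < c z g]].

Let kM := regular_no_max k_reg.
Let lM := regular_no_max l_reg.

Lemma agree_sym z b b' : agree z b b' -> agree z b' b.
Proof. by move=> bb' y yz; rewrite bb'. Qed.

Lemma agree_trans z b b' b'' : agree z b b' -> agree z b' b'' -> agree z b b''.
Proof. by move=> bb' b'b'' y yz; rewrite bb'// b'b''. Qed.

Lemma agree_le z z' b b' : z <= z' -> agree z' b b' -> agree z b b'.
Proof. by move=> zz' bb' y yz; apply: bb'; apply: lt_le_trans zz'. Qed.

Lemma cofinal_ge B x : cofinal_in k B -> x < k -> cofinal_in k [set b | B b /\ x <= b].
Proof.
move=> [Bk Bcof] xk; split=> [b [/Bk]//|y yk].
have [|b Bb] := Bcof (Order.max x y); first by rewrite gt_max xk.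
by rewrite ge_max => /andP[xb yb]; exists b.
Qed.

Lemma cofinal_sub B (B' : set O) : B `<=` B' -> B' `<=` below k -> cofinal_in k B ->
  cofinal_in k B'.
Proof. by move=> BB' B'k [_ Bcof]; split=> // x /Bcof[b /BB' B'b xb]; exists b. Qed.

(** If each level had a value [p.1] reached only below some [p.2 < k], the points of [B] beyond all
    the [p.2] would violate strong unboundedness. *)
Lemma ex_unbounded_level B : cofinal_in k B -> exists2 z, z < l &
  forall j, j < l -> cofinal_in k [set g | B g /\ j <= c z g].
Proof.
move=> Bcof; apply: contrapT => nz.
have /choice[p pP] : forall z, exists p : O * O, z < l ->
    [/\ p.1 < l, p.2 < k & forall g, B g -> p.1 <= c z g -> g < p.2].
  move=> z; have [zl|] := boolP (z < l); last by exists (z, z).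
  apply: contrapT => np; apply: nz; exists z => // j jl.
  apply: contrapT => /not_cofinal[g [/Bcof.1]//|s sk sP].
  by apply: np; exists (j, s) => _; split=> // g Bg jg; apply: sP.
have [z /pP[]//|s sk sP] := cf_bound (F := fun z => (p z).2) k_reg.2 lk.
have [z [g0 [zl _ unb]]] := c_unb (cofinal_ge Bcof sk).
have [p1l _ p2P] := pP z zl; have [g [[Bg sg] _ vg]] := unb _ p1l.
have := lt_trans (p2P g Bg (ltW vg)) (sP _ zl).
by rewrite ltNge sg.
Qed.

(** On a cofinal set of points [g] with the same [c_g] no value could grow, so each class of equal
    [c_g] is bounded in [k]; [dist x] lies beyond the classes of all points up to [x]. *)
Lemma ex_separating : exists dist : O -> O, forall x, x < k -> dist x < k /\
  forall g g', g' <= x -> dist x <= g -> g < k -> exists2 z, z < l & c z g <> c z g'.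
Proof.
have /choice[p pP] : forall g', exists s, g' < k -> s < k /\
    forall g, g < k -> s <= g -> exists2 z, z < l & c z g <> c z g'.
  move=> g'; have [g'k|] := boolP (g' < k); last by exists g'.
  have [|/c_unb[z [g0 [zl _ unb]]]|s sk sP] :=
    @not_cofinal _ _ k [set g | g < k /\ forall z, z < l -> c z g = c z g'].
  - by move=> g [].
  - have [g [[_ gg'] _]] := unb (c z g') (c_lt zl g'k).
    by rewrite gg'// ltxx.
  exists s => _; split=> // g gk sg; apply: contrapT => nz.
  suff /sP : g < k /\ forall z, z < l -> c z g = c z g' by rewrite ltNge sg.
  by split=> // z zl; apply: contrapT => ne; apply: nz; exists z.
suff /choice[dist distP] : forall x, exists s, x < k -> s < k /\
    forall g g', g' <= x -> s <= g -> g < k -> exists2 z, z < l & c z g <> c z g'.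
  by exists dist.
move=> x; have [xk|] := boolP (x < k); last by exists x.
have [y xy yk] := kM xk.
have [g' g'y|s sk sP] := cf_bound (F := p) k_reg.2 yk.
  by have [] := pP g' (lt_trans g'y yk).
exists s => _; split=> // g g' g'x sg gk.
have g'y := le_lt_trans g'x xy; apply: (pP g' (lt_trans g'y yk)).2 => //.
by apply: le_trans sg; apply/ltW/sP.
Qed.

(** By recursion on [i], the points with index [i] are taken beyond [dist] of a bound of all earlier
    ones. *)
Lemma ex_picks a (X : O -> O -> set O) : a < k ->
  (forall i t, i < l -> t < l -> cofinal_in k (X i t)) ->
  exists pk : O -> O -> O,
  (forall i t, i < l -> t < l -> [/\ X i t (pk i t), a <= pk i t & pk i t < k]) /\
  forall i i' t t', i < l -> i' < l -> t < l -> t' < l -> i <> i' ->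
    exists2 z, z < l & c z (pk i t) <> c z (pk i' t').
Proof.
move=> ak Xcof; have [dist distP] := ex_separating.
pose Q i (f : O -> O -> O) (v : O -> O) := forall t, t < l ->
  [/\ X i t (v t), a <= v t, v t < k & forall i' t', i' < i -> t' < l ->
     exists2 z, z < l & c z (v t) <> c z (f i' t')].
have [|i f il IH|pk pkP] := @wo_rec_choice _ _ wo _ id (below l) Q.
- move=> i f g v fg Qv t tl; have [Xv av vk vf] := Qv t tl.
  by split=> // i' t' i'i t'l; rewrite -fg//; apply: vf.
- have [i' t' i'i t'l|s sk sP] := cf_bound2 (F := f) k_reg.2 (lt_trans il lk) lk.
    by have [] := IH i' i'i (lt_trans i'i il) t' t'l.
  have [dk dP] := distP s sk.
  have yk : Order.max a (dist s) < k by rewrite gt_max ak.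
  suff /choice[v vP] : forall t, exists v, t < l ->
      [/\ X i t v, a <= v, v < k & dist s <= v].
    exists v => t tl; have [Xv av vk sv] := vP t tl; split=> // i' t' i'i t'l.
    by apply: dP => //; apply/ltW/sP.
  move=> t; have [tl|] := boolP (t < l); last by exists t.
  have [v Xv] := (Xcof i t il tl).2 _ yk; rewrite ge_max => /andP[av sv].
  by exists v => _; split=> //; apply: (Xcof i t il tl).1.
exists pk; split=> [i t il tl|i i' t t' il i'l tl t'l ii'].
  by have [] := pkP i il t tl.
case: (ltgtP i i') => // [lti|lti].
  have [_ _ _ /(_ i t lti tl)[z zl ne]] := pkP i' i'l t' t'l.
  by exists z => // E; apply: ne.
have [_ _ _] := pkP i il t tl; exact.
Qed.

Lemma cf_bound4 i j i' j' (F : O -> O -> O -> O -> O) :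
  i < l -> j < l -> i' < l -> j' < l ->
  (forall x y z t, x < i -> y < j -> z < i' -> t < j' -> F x y z t < l) ->
  exists2 s, s < l &
    forall x y z t, x < i -> y < j -> z < i' -> t < j' -> F x y z t < s.
Proof.
move=> il jl i'l j'l Fl.
have /choice[G GP] : forall p : O * O, exists s, p.1 < i -> p.2 < j ->
    s < l /\ forall z t, z < i' -> t < j' -> F p.1 p.2 z t < s.
  move=> [x y] /=; have [xi|] := boolP (x < i); last by exists x.
  have [yj|] := boolP (y < j); last by exists x.
  have [s sl sP] := cf_bound2 l_reg.2 i'l j'l (fun z t => Fl x y z t xi yj).
  by exists s.
have [x y xi yj|s sl sP] := cf_bound2 (F := fun x y => G (x, y)) l_reg.2 il jl.
  by have [] := GP (x, y) xi yj.
exists s => // x y z t xi yj zi tj; apply: lt_trans (sP x y xi yj).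
by apply: (GP (x, y) xi yj).2.
Qed.

(** Fewer than [l] points are involved, so the levels where they differ are bounded by some [n < l]
    above [hm], and [v] bounds their values below level [n]. *)
Lemma ex_threshold hm j (pk : O -> O -> O) : hm < l -> j < l ->
  (forall i t, i < j -> t < j -> pk i t < k) ->
  (forall i i' t t', i < j -> i' < j -> t < j -> t' < j -> i <> i' ->
    exists2 z, z < l & c z (pk i t) <> c z (pk i' t')) ->
  exists2 v, v < l & (forall i t z, i < j -> t < j -> z <= hm -> c z (pk i t) <= v) /\
    forall i i' t t', i < j -> i' < j -> t < j -> t' < j -> i <> i' ->
      exists2 z, c z (pk i t) <> c z (pk i' t') &
        forall y, y <= z -> c y (pk i t) <= v.
Proof.
move=> hml jl pkk pkne.
have /choice[D DP] : forall p : O * O * O * O, exists z, let: (i, i', t, t') := p in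
    i < j -> i' < j -> t < j -> t' < j ->
    z < l /\ (i <> i' -> c z (pk i t) <> c z (pk i' t')).
  move=> [[[i i'] t] t']; have [E|/eqP ne] := eqVneq i i'.
    by exists hm.
  have [ij|] := boolP (i < j); last by exists i.
  have [i'j|] := boolP (i' < j); last by exists i.
  have [tj|] := boolP (t < j); last by exists i.
  have [t'j|] := boolP (t' < j); last by exists i.
  by have [z zl zne] := pkne i i' t t' ij i'j tj t'j ne; exists z.
have [i i' t t' ij i'j tj t'j|s sl sP] :=
  @cf_bound4 j j j j (fun i i' t t' => D (i, i', t, t')) jl jl jl jl.
  by have [] := DP (i, i', t, t') ij i'j tj t'j.
have [n [sn hmn nl]] := no_max2 lM sl hml.
have [i t y _ ij tj yn _|v vl vP] :=
  @cf_bound4 j j n n (fun i t y _ => c y (pk i t)) jl jl nl nl.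
  by apply: c_lt; [apply: lt_trans nl|apply: pkk].
exists v => //; split=> [i t z ij tj zhm|i i' t t' ij i'j tj t'j ii'].
  by apply/ltW/(vP i t z hm) => //; apply: le_lt_trans hmn.
have [zl zne] := DP (i, i', t, t') ij i'j tj t'j.
exists (D (i, i', t, t')); first exact: zne.
move=> y yz; apply/ltW/(vP i t y hm) => //.
by apply: le_lt_trans yz _; apply: lt_trans sn; apply: sP.
Qed.

(** When [n] and [s] are below [k], fewer than [k] pairs [(g, z)] represent all nodes of level below
    [n], and regularity handles them at once; from [n] on the tree of [B] no longer branches. *)
Definition thin B n s :=
  [/\ forall b z, B b -> z < n -> cofinal_in k [set b' | B b' /\ agree z b b'],
      forall b b' z, B b -> B b' -> n <= z -> z < l -> agree z b b' -> b = b' &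
      forall b z, B b -> z < n -> exists2 g, g < s & agree z g b].

(** [n] is the first level at which the least representatives of the nodes are cofinal, and these
    form [B1]; if there is none, [n] is [l] and [B1] is [B]. Below [n] the representatives are
    bounded by [s], and cutting [B1] at [u] removes the nodes met only boundedly. *)
Lemma ex_thin B : cofinal_in k B -> exists B' n s,
  [/\ B' `<=` B, cofinal_in k B', n < k, s < k & thin B' n s].
Proof.
move=> Bcof.
pose R z := [set b | B b /\ forall b', B b' -> b' < b -> ~ agree z b' b].
have [n [B1 [nl B1B B1cof B1C2 Rn]]] : exists n B1, [/\ n <= l, B1 `<=` B,
    cofinal_in k B1,
    forall b b' z, B1 b -> B1 b' -> n <= z -> z < l -> agree z b b' -> b = b' &
    forall z, z < n -> ~ cofinal_in k (R z)].
  have [ex|nex] := pselect (exists z, z < l /\ cofinal_in k (R z)); last first.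
    exists l, B; split=> //; last by move=> z zl Rz; apply: nex; exists z.
    by move=> b b' z _ _ lz; rewrite ltNge lz.
  have [n [nl Rn] nmin] := ex_least wo ex.
  exists n, (R n); split=> //; first exact: ltW.
    by move=> b [].
    move=> b b' z [Bb bR] [Bb' b'R] nz _ bb'.
    case: (ltgtP b b') => // [ltb|ltb].
      by case: (b'R b Bb ltb); apply: agree_le bb'.
    by case: (bR b' Bb' ltb); apply: agree_le nz _; apply: agree_sym.
  move=> z zn Rz; have := nmin z (conj (lt_trans zn nl) Rz).
  by rewrite leNgt zn.
have nk : n < k by apply: le_lt_trans lk.
have /choice[S SP] : forall z, exists s, z < n -> s < k /\ forall b, R z b -> b < s.
  move=> z; have [zn|] := boolP (z < n); last by exists z.
  have [b [/Bcof.1]//|s sk sP] := not_cofinal _ (Rn z zn).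
  by exists s.
have [z /SP[]//|s sk sP] := cf_bound (F := S) k_reg.2 nk.
have rep b z : B b -> z < n -> exists2 g, g < s & agree z g b.
  move=> Bb zn; have [|g [Bg gb] gmin] := @ex_least _ _ wo (fun g => B g /\ agree z g b).
    by exists b; split.
  exists g => //; apply: lt_trans (sP z zn); apply: (SP z zn).2; split=> // g' Bg' g'g.
  move=> ag; have := gmin g' (conj Bg' (agree_trans ag gb)).
  by rewrite leNgt g'g.
have /choice[U UP] : forall p : O * O, exists u, u < k /\
    (cofinal_in k [set b | B1 b /\ agree p.2 p.1 b] \/
     forall b, B1 b -> agree p.2 p.1 b -> b < u).
  move=> [g z] /=.
  have [gc|/not_cofinal[b [/B1cof.1]//|u uk uP]] :=
    pselect (cofinal_in k [set b | B1 b /\ agree z g b]); first by exists s; split=> //; left.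
  by exists u; split=> //; right => b B1b ag; apply: uP.
have [g z _ _|u uk uP] := cf_bound2 (F := fun g z => U (g, z)) k_reg.2 sk nk.
  by case: (UP (g, z)).
exists [set b | B1 b /\ u <= b], n, s; split=> //.
- by move=> b [/B1B].
- exact: cofinal_ge.
split=> [b z [B1b ub] zn|b b' z [B1b _] [B1b' _]|b z [/B1B Bb _] zn].
- have [g gs gb] := rep b z (B1B _ B1b) zn.
  have [_ [gc|/(_ b B1b gb) /= bU]] := UP (g, z); last first.
    by have := lt_trans bU (uP g z gs zn); rewrite ltNge ub.
  apply: cofinal_sub (cofinal_ge gc uk); last by move=> ? [[/B1cof.1]].
  move=> b' [[B1b' gb'] ub']; split=> //; apply: agree_trans gb'; exact: agree_sym.
- exact: B1C2.
- exact: rep.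
Qed.

(* If all large points of [G] were exceptions, strong unboundedness would
   provide a node with unboundedly many successors among the exceptions; a
   single point [b] of [B] through this node then refutes one of them. *)
Lemma generic_branch B n s (G : set O) dl x v (w : O -> O) :
  thin B n s -> B `<=` below k -> cofinal_in k G ->
  (forall g z, G g -> z < l -> exists2 b, B b & agree z g b) ->
  (forall g z, g < s -> z < n -> cofinal_in k [set b | B b /\ agree z g b] ->
     exists b, [/\ B b, agree z g b, x <= b & b < dl]) ->
  v < l -> (forall b, w b < l) ->
  exists2 y, y < k & forall g, G g -> y <= g ->
    exists b z, [/\ B b, x <= b /\ b < dl, z < l, agree z b g & v < c z g /\ w b < c z g].
Proof.
move=> [BC1 BC2 BC3] Bk Gcof GB dlgood vl wl.
pose good g := exists b z,
  [/\ B b, x <= b /\ b < dl, z < l, agree z b g & v < c z g /\ w b < c z g].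
have [/c_unb[z [g0 [zl [Gg0 _] unb]]]|/not_cofinal[g [/Gcof.1]//|y yk yP]] :=
  pselect (cofinal_in k [set g | G g /\ ~ good g]); last first.
  exists y => // g Gg yg; apply: contrapT => ng.
  by have := yP g (conj Gg ng); rewrite ltNge yg.
(* From level [n] on a node determines the point of [B] through it, which fixes the value of [c z]
   and contradicts its growth. *)
have zn : z < n.
  rewrite ltNge; apply/negP => nz.
  have [z1 zz1 z1l] := lM zl.
  have g0k := Gcof.1 _ Gg0.
  have [g [[Gg _] ag vg]] := unb (c z g0) (c_lt zl g0k).
  have [b0 Bb0 ab0] := GB g0 z1 Gg0 z1l; have [b Bb ab] := GB g z1 Gg z1l.
  have E : b0 = b.
    apply: (BC2 b0 b z) => //.
    apply: (agree_trans (agree_le (ltW zz1) (agree_sym ab0))).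
    exact: (agree_trans ag (agree_le (ltW zz1) ab)).
  by move: vg; rewrite (ab z zz1) (ab0 z zz1) E ltxx.
have [b0 Bb0 ab0] := GB g0 z Gg0 zl.
have [g1 g1s ag1] := BC3 b0 z Bb0 zn.
have [|b [Bb ab xb bdl]] := dlgood g1 z g1s zn.
  have [_ ccof] := BC1 b0 z Bb0 zn; split=> [b [/Bk]//|y /ccof[b [Bb ab] yb]].
  by exists b => //; split=> //; apply: agree_trans ab.
have ml : Order.max v (w b) < l by rewrite gt_max vl wl.
have [g [[Gg ng] ag]] := unb _ ml; rewrite gt_max => /andP[vg wg].
case: ng; exists b, z; split=> //.
apply: (agree_trans (agree_sym ab)); apply: (agree_trans ag1).
exact: (agree_trans (agree_sym ab0) ag).
Qed.

End Coloring.

(** * The almost disjoint sets and their guessing property *)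

Section Core.
Context {d : Order.disp_t} {O : orderType d} (wo : well_ordered O).
Implicit Types (a b x y z i j t u v dl : O) (B G : set O).
Variables (l k : O) (c : O -> O -> O).
Hypotheses (l_reg : regular_cardinal l) (k_reg : regular_cardinal k) (lk : l < k).
Hypothesis c_lt : forall z b, z < l -> b < k -> c z b < l.
Hypothesis c_unb : forall B, cofinal_in k B -> exists z g0, [/\ z < l, B g0 &
  forall v, v < l -> exists g, [/\ B g, agree c z g0 g & v < c z g]].

Variable Z : set O.
Hypotheses (Zk : forall a, Z a -> a < k) (Zcf : forall a, Z a -> is_cf a l).
Hypothesis Zhit : hits_closed k Z.

Variables (e h : O -> O) (g rho : O -> O -> O).
Hypothesis h_fibers : forall i x, i < l -> x < l ->
  exists y, [/\ x <= y, y < l & h y = i].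
Hypothesis g_lt : forall a j, Z a -> j < l -> g a j < a.
Hypothesis g_mono : forall a i j, Z a -> i < j -> j < l -> g a i < g a j.
Hypothesis g_cof : forall a x, Z a -> x < a -> exists2 j, j < l & x <= g a j.
Hypothesis g_e : forall a j, Z a -> j < l -> j <= e (g a j).
Hypothesis rho_lt : forall a b, Z a -> b < a -> rho a b < l.
Hypothesis rho_gt : forall a b j, Z a -> b < a -> j < l -> g a j < b -> j < rho a b.
Hypothesis rho_const : forall a dl, Z a -> is_cf dl l -> dl < a ->
  exists2 x, x < dl & exists2 j, j < l & forall b, x <= b -> b < dl -> rho a b = j.
Hypothesis rho_g : forall a j, Z a -> j < l -> rho a (g a j) = j.

Variables (Gam : O -> O -> set O) (lev : O -> O -> O) (hm : O -> O).
Variables (m : O -> O -> O) (pk : O -> O -> O -> O -> O) (thr : O -> O -> O).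
Hypothesis hm_lt : forall a, Z a -> hm a < l.
Hypothesis lev_le : forall a t, Z a -> t < l -> lev a t <= hm a.
Hypothesis m_lt : forall a b, a < k -> m a b < l.
Hypothesis m_ge : forall a dl, a < k -> Z dl -> dl < a ->
  exists2 x, x < dl & forall b, x <= b -> b < dl -> hm dl <= m a b.
Hypothesis m_le : forall a dl, a < k -> Z dl -> dl < a ->
  exists2 x, x < dl & exists2 u, u < l &
    forall b, x <= b -> b < dl -> m a b <= Order.max (m dl b) u.
Hypothesis pkP : forall a j i t, Z a -> j < l -> i < l -> t < l ->
  [/\ Gam a t (pk a j i t), a <= pk a j i t, pk a j i t < k &
      j <= c (lev a t) (pk a j i t)].
Hypothesis thr_lt : forall a j, Z a -> j < l -> thr a j < l.
Hypothesis thr_hm : forall a j i t z, Z a -> j < l -> i < j -> t < j -> z <= hm a ->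
  c z (pk a j i t) <= thr a j.
Hypothesis thr_sep : forall a j i i' t t', Z a -> j < l ->
  i < j -> i' < j -> t < j -> t' < j -> i <> i' ->
  exists2 z, c z (pk a j i t) <> c z (pk a j i' t') &
    forall y, y <= z -> c y (pk a j i t) <= thr a j.

(** [i < j] and [t < j] leave fewer than [l] branches per interval, so that a threshold [thr a j]
    can exist; [e b < j] keeps out the ladder points, where [e] is at least the index. *)
Definition guess_part a i b : Prop := let j := rho a b in
  [/\ i < j, e b < j & exists t z,
    [/\ t < j, z < l, agree c z b (pk a j i t), thr a j < c z (pk a j i t) &
        forall y, y <= m a b -> c y b < c z (pk a j i t)]].

(** The ladder points of [a] are distributed over the indices [i] by the fibers of [h], which are
    cofinal in [l]. *)
Definition ad_set a i : set O := [set b | b < a /\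
  (guess_part a i b \/ (b = g a (rho a b) /\ h (rho a b) = i))].

Let lM := regular_no_max l_reg.
Let kM := regular_no_max k_reg.

Lemma Z_no_max a : Z a -> no_max a.
Proof. by move=> /Zcf/cf_no_max; apply; apply: regular_gt1. Qed.

(** Two branches with different [i] differ at a level reached before the threshold is exceeded,
    hence below both [z] and [z'], where [b] agrees with both. *)
Lemma ad_set_disjoint a i i' b : Z a ->
  ad_set a i b -> ad_set a i' b -> i = i'.
Proof.
move=> Za [ba Ab] [_ Ab']; apply: contrapT => ii'.
have jl := rho_lt Za ba.
case: Ab Ab' => [[ij ej [t [z [tj zl zag zthr _]]]]|[bg hi]]
  [[i'j ej' [t' [z' [t'j z'l z'ag z'thr _]]]]|[bg' hi']].
(* [thr_sep] bounds only the first of the two branches, so the one with the smaller level is put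
   first. *)
- wlog zz' : i i' t t' z z' ii' ij tj zl zag zthr i'j t'j z'l z'ag z'thr / z <= z'.
    move=> W; have [zz'|/ltW z'z] := leP z z'.
      exact: (W i i' t t' z z').
    apply: (W i' i t' t z' z) => // E; exact: ii'.
  have [y ne yP] := thr_sep Za jl ij i'j tj t'j ii'.
  have [zy|yz] := leP z y; first by have := yP z zy; rewrite leNgt zthr.
  by apply: ne; rewrite -(zag y yz) -(z'ag y (lt_le_trans yz zz')).
- by have := g_e Za jl; rewrite -bg' leNgt ej.
- by have := g_e Za jl; rewrite -bg leNgt ej'.
- by apply: ii'; rewrite -hi -hi'.
Qed.

Lemma ad_set_cofinal a i : Z a -> i < l -> cofinal_in a (ad_set a i).
Proof.
move=> Za il; split=> [b []//|x xa].
have [j0 j0l xj0] := g_cof Za xa; have [j [j0j jl hj]] := h_fibers il j0l.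
exists (g a j); first by split; [apply: g_lt|right; rewrite rho_g].
apply: le_trans xj0 _; move: j0j; rewrite le_eqVlt => /orP[/eqP ->//|j0j].
exact/ltW/g_mono.
Qed.

Lemma ad_set_ad a a' i i' : Z a -> Z a' -> a' < a ->
  exists2 x, x < a' & forall b, ad_set a i b -> ad_set a' i' b -> b < x.
Proof.
move=> Za Za' a'a; have ak := Zk Za; have a'M := Z_no_max Za'.
have [x1 x1a' [j jl jP]] := rho_const Za (Zcf Za') a'a.
have [x2 x2a' x2P] := m_ge ak Za' a'a.
have [n hmn nl] := lM (hm_lt Za').
(* Fewer than [l] branches serve for the interval [j] of [a]; [V0] bounds their values at levels up
   to [hm a']. *)
have [V0 V0l V0P] : exists2 V, V < l & forall i t y, i < j -> t < j -> y <= hm a' ->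
    c y (pk a j i t) < V.
  have [i0 t y _ ij tj yn _|V Vl VP] := cf_bound4 l_reg (i := j) (j := j) (i' := n) (j' := n)
    (F := fun i t y _ => c y (pk a j i t)) jl jl nl nl.
    apply: c_lt; first exact: lt_trans nl.
    by have [] := pkP Za jl (lt_trans ij jl) (lt_trans tj jl).
  exists V => // i0 t y ij tj yh; apply: (VP i0 t y (hm a')) => //.
  exact: le_lt_trans hmn.
pose V := Order.max V0 j; have Vl : V < l by rewrite gt_max V0l.
have [x3 [x13 gx3 x3a']] := no_max2 a'M x1a' (g_lt Za' Vl).
have [x4 x4a' x4P] : exists2 x4, x4 < a' & (g a j < a' -> g a j < x4).
  have [ga'|] := boolP (g a j < a'); last by exists x1.
  by have [x4 gx4 x4a'] := a'M _ ga'; exists x4.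
exists (Order.max (Order.max x2 x3) x4).
  by rewrite !gt_max x2a' x3a' x4a'.
move=> b [ba Ab] [ba' Ab']; rewrite ltNge; apply/negP.
rewrite !ge_max => /andP[/andP[x2b x3b] x4b].
have rj : rho a b = j by apply: jP => //; apply: le_trans x3b; apply: ltW.
have Vj' : V < rho a' b by apply: rho_gt => //; apply: lt_le_trans x3b.
have j'l := rho_lt Za' ba'.
case: Ab => [[]|[bg _]]; last first.
  rewrite rj in bg; have ga' : g a j < a' by rewrite -bg.
  by have := x4P ga'; rewrite -bg ltNge x4b.
rewrite rj => ij ej [t [z [tj zl zag _ zm]]].
case: Ab' => [[i'j' _ [t' [z' [t'j' z'l z'ag z'thr _]]]]|[bg _]]; last first.
  have := g_e Za' j'l; rewrite -bg leNgt (lt_trans ej)//.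
  by apply: le_lt_trans Vj'; rewrite le_max lexx orbT.
set j' := rho a' b in Vj' j'l i'j' t'j' z'ag z'thr.
have q_hm := lev_le Za' (lt_trans t'j' j'l); set q := lev a' t' in q_hm.
have qz' : q < z'.
  rewrite ltNge; apply/negP => z'q.
  have := thr_hm Za' j'l i'j' t'j' (le_trans z'q q_hm).
  by rewrite leNgt z'thr.
(* Membership at [a'] forces a value at least [j'], which is above [V0] near [a'], at the level
   [q <= hm a']. *)
have j'q : j' <= c q b.
  rewrite (z'ag q qz').
  by have [] := pkP Za' j'l (lt_trans i'j' j'l) (lt_trans t'j' j'l).
have V0j' : V0 < j' by apply: le_lt_trans Vj'; rewrite le_max lexx.
have qm : q <= m a b by apply: le_trans q_hm _; apply: x2P.
(* If [z <= hm a'], the branch at [z] is below [V0] and yet exceeds [c q b]; otherwise [b] agrees at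
   [q] with the branch, which is below [V0] there. *)
have [zhm|hmz] := leP z (hm a').
  have := V0P i t z ij tj zhm.
  by rewrite ltNge (le_trans (ltW V0j'))// (le_trans j'q)// ltW// zm.
have := V0P i t q ij tj q_hm.
by rewrite -(zag q (le_lt_trans q_hm hmz)) ltNge (le_trans (ltW V0j')).
Qed.

(** [F] has to be fixed before [a], whereas the threshold [thr a j] and the bound [u] of [m_le]
    depend on [a]; hence [Y dl] is chosen for all their possible values at once. *)
Lemma ad_set_guess B n s G eb : thin l k c B n s -> n < k -> s < k ->
  B `<=` below k -> cofinal_in k G ->
  (forall b, B b -> e b < eb) -> eb < l ->
  (forall g z, G g -> z < l -> exists2 b, B b & agree c z g b) ->
  exists2 F : O -> O, closed_under F k & forall a t i x, Z a -> closed_under F a ->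
    t < l -> Gam a t = G -> i < l -> x < a ->
    exists b, [/\ ad_set a i b, B b & x <= b].
Proof.
move=> Bthin nk sk Bk Gcof eeb ebl GB.
(* Between [x] and [Phi x] there is a point of [B] through every represented node that is met
   cofinally often. *)
have /choice[Phi PhiP] : forall x, exists y, x < k -> y < k /\
    forall g z, g < s -> z < n -> cofinal_in k [set b | B b /\ agree c z g b] ->
      exists b, [/\ B b, agree c z g b, x <= b & b < y].
  move=> x; have [xk|] := boolP (x < k); last by exists x.
  have /choice[f fP] : forall p : O * O, exists b, b < k /\
      (cofinal_in k [set b | B b /\ agree c p.2 p.1 b] ->
       [/\ B b, agree c p.2 p.1 b & x <= b]).
    move=> [g' z] /=.
    have [[_ /(_ x xk)[b [Bb ab] xb]]|] :=
      pselect (cofinal_in k [set b | B b /\ agree c z g' b]); last by exists x.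
    by exists b; split=> //; apply: Bk.
  have [g' z _ _|y yk yP] := cf_bound2 (F := fun g z => f (g, z)) k_reg.2 sk nk.
    by case: (fP (g', z)).
  exists y => _; split=> // g' z gs zn /(fP (g', z)).2[Bf af xf].
  by exists (f (g', z)); split=> //; apply: yP.
have /choice[N NP] : forall x, exists dl, x < k ->
    [/\ Z dl, closed_under Phi dl & x < dl].
  move=> x; have [xk|] := boolP (x < k); last by exists x.
  have [x' xx' x'k] := kM xk.
  have [y yk|dl Zdl dlC] := Zhit (F := fun y => Order.max x' (Phi y)).
    by rewrite gt_max x'k; have [] := PhiP y yk.
  exists dl => _; split=> //.
    by move=> y ydl; apply: le_lt_trans (dlC y ydl); rewrite le_max lexx orbT.
  apply: lt_trans xx' _.
  have [f f_lt _] := cofinal_map_total (Zcf Zdl).1.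
  have [y [y' [yy' y'l]]] := regular_gt1 l_reg.
  have := dlC _ (f_lt y' y'l); rewrite gt_max => /andP[].
  by [].
(* [w] is built from [m dl b] and [u] instead of [m a b], so as not to refer to [a]. *)
have /choice[w wP] : forall p : O * O * O, exists w, w < l /\
    forall y, p.1.1 < k -> p.1.2 < l -> p.2 < k ->
      y <= Order.max (m p.1.1 p.2) p.1.2 -> c y p.2 <= w.
  move=> [[dl u] b] /=; have [dlk|] := boolP (dl < k); last by exists eb.
  have [ul|] := boolP (u < l); last by exists eb.
  have [bk|] := boolP (b < k); last by exists eb.
  have ml : Order.max (m dl b) u < l by rewrite gt_max m_lt.
  have [y my yl] := lM ml.
  have [z zy|v vl vP] := cf_bound (F := fun z => c z b) l_reg.2 yl.
    by apply: c_lt => //; apply: lt_trans yl.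
  by exists v; split=> // z _ _ _ zm; apply/ltW/vP; apply: le_lt_trans my.
pose good dl x v u g := exists b z, [/\ B b, x <= b /\ b < dl, z < l,
  agree c z b g & v < c z g /\ w (dl, u, b) < c z g].
have /choice[Y YP] : forall dl, exists y, Z dl -> closed_under Phi dl ->
    y < k /\ forall x v u g, x < dl -> v < l -> u < l -> G g -> y <= g -> good dl x v u g.
  move=> dl; have [Zdl|] := pselect (Z dl); last by exists dl.
  have [dlC|] := pselect (closed_under Phi dl); last by exists dl.
  have dlk := Zk Zdl.
  have /choice[f fP] : forall p : O * O * O, exists y, p.1.1 < dl -> p.1.2 < l ->
      p.2 < l -> y < k /\ forall g, G g -> y <= g -> good dl p.1.1 p.1.2 p.2 g.
    move=> [[x v] u] /=; have [xdl|] := boolP (x < dl); last by exists x.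
    have [vl|] := boolP (v < l); last by exists x.
    have [ul|] := boolP (u < l); last by exists x.
    have [|b|y yk yP] := generic_branch l_reg c_lt c_unb (dl := dl) (x := x) (v := v)
      (w := fun b => w (dl, u, b)) Bthin Bk Gcof GB _ vl.
    - move=> g' z g's zn gcof.
      have [_ /(_ g' z g's zn gcof)[b [Bb ab xb bP]]] := PhiP x (lt_trans xdl dlk).
      by exists b; split=> //; apply: lt_trans (dlC x xdl).
    - by case: (wP (dl, u, b)).
    by exists y.
  have /choice[f' f'P] : forall x, exists y, x < dl -> y < k /\
      forall v u, v < l -> u < l -> f (x, v, u) < y.
    move=> x; have [xdl|] := boolP (x < dl); last by exists x.
    have [v u vl ul|y yk yP] := cf_bound2 (F := fun v u => f (x, v, u)) k_reg.2 lk lk.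
      by have [] := fP (x, v, u) xdl vl ul.
    by exists y.
  have [x /f'P[]//|y yk yP] := cf_bound (F := f') k_reg.2 dlk.
  exists y => _ _; split=> // x v u g' xdl vl ul Gg yg.
  have [_] := fP (x, v, u) xdl vl ul; apply=> //; apply: le_trans yg.
  apply/ltW/(lt_trans _ (yP x xdl)); exact: (f'P x xdl).2.
exists (fun x => Order.max (N x) (Y (N x))).
  move=> x xk; have [ZN NC _] := NP x xk; rewrite gt_max Zk//=.
  by have [] := YP _ ZN NC.
move=> a t i x Za aF tl GamG il xa; have ak := Zk Za.
(* Points of [a] beyond [g a j0] have index above [i], [t] and [eb], as [guess_part] requires. *)
have [j1 [tj1 ij1 j1l]] := no_max2 lM tl il.
have [j0 [j10 ebj0 j0l]] := no_max2 lM j1l ebl.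
pose x' := Order.max x (g a j0).
have x'a : x' < a by rewrite gt_max xa g_lt.
have [ZN NC x'N] := NP x' (lt_trans x'a ak).
have := aF x' x'a; rewrite gt_max => /andP[Na YNa].
set dl := N x' in ZN NC x'N Na YNa.
have [x1 x1dl [j jl jP]] := rho_const Za (Zcf ZN) Na.
have [x2 x2dl [u ul uP]] := m_le ak ZN Na.
have [x3 x'x3 x3dl] := Z_no_max ZN x'N.
pose X := Order.max (Order.max x1 x2) x3.
have Xdl : X < dl by rewrite !gt_max x1dl x2dl.
have [Gp ap pkk _] := pkP Za jl il tl; rewrite GamG in Gp.
have [_ /(_ X (thr a j) u _ Xdl (thr_lt Za jl) ul Gp)[]] := YP dl ZN NC.
  by apply: le_trans ap; apply: ltW.
move=> b [z [Bb [Xb bdl] zl ab [tz wz]]].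
move: Xb; rewrite !ge_max => /andP[/andP[x1b x2b] x3b].
have x'b : x' < b by apply: lt_le_trans x3b.
have ba := lt_trans bdl Na.
have rj : rho a b = j by apply: jP.
have j0j : j0 < j.
  rewrite -rj; apply: rho_gt => //; apply: le_lt_trans x'b.
  by rewrite le_max lexx orbT.
exists b; split=> //; last by apply/ltW/(le_lt_trans _ x'b); rewrite le_max lexx.
split=> //; left; rewrite /guess_part rj; split.
- exact: lt_trans (lt_trans ij1 j10) j0j.
- exact: lt_trans (eeb b Bb) (lt_trans ebj0 j0j).
exists t, z; split=> //; first exact: lt_trans (lt_trans tj1 j10) j0j.
move=> y ym; apply: le_lt_trans wz.
apply: (wP (dl, u, b)).2 => //=; [exact: Zk|exact: Bk|].
by apply: le_trans ym _; apply: uP.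
Qed.

End Core.

(** * Big trees, and the coloring as a function on ordinals *)

Section Trees.
Context {d : Order.disp_t} {O : orderType d}.
Variables (l k : O) (c : seg l -> seg k -> seg l).
Hypotheses (l_reg : regular_cardinal l) (k_reg : regular_cardinal k).

(* Junk value [l] outside the domain of [c]. *)
Definition color (z b : O) : O :=
  if pselect (z < l) is left zl then
    if pselect (b < k) is left bk then sval (c (exist _ z zl) (exist _ b bk)) else l
  else l.

Lemma seg_inj (a : O) (x y : seg a) : sval x = sval y -> x = y.
Proof.
by case: x y => [x xa] [y ya] /= E; subst y; congr exist; apply: bool_irrelevance.
Qed.

Lemma colorE (z : seg l) (b : seg k) : color (sval z) (sval b) = sval (c z b).
Proof.
rewrite /color; case: pselect => [zl|/(_ (svalP z))//].
case: pselect => [bk|/(_ (svalP b))//].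
by congr (sval (c _ _)); apply: seg_inj.
Qed.

Lemma color_lt z b : z < l -> b < k -> color z b < l.
Proof.
move=> zl bk; rewrite (colorE (exist _ z zl) (exist _ b bk)).
exact: (svalP (c _ _)).
Qed.

Lemma fiber_restr_agree (z : seg l) (b b' : seg k) :
  fiber_restr c b z = fiber_restr c b' z <-> agree color (sval z) (sval b) (sval b').
Proof.
split=> [E y yz|E].
  have := congr1 (fun f => f (exist _ y yz)) E; rewrite /fiber_restr => Ey.
  by rewrite -[y]/(sval (seg_widen (exist _ y yz))) !colorE Ey.
apply/funext => x; apply: seg_inj; rewrite /fiber_restr -!colorE.
exact: E (svalP x).
Qed.

Lemma color_unbounded : strongly_unbounded c ->
  forall B, cofinal_in k B -> exists z g0, [/\ z < l, B g0 &
    forall v, v < l -> exists g, [/\ B g, agree color z g0 g & v < color z g]].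
Proof.
move=> cunb B /cunb[z [t tsup]].
have [x [y [xy yl]]] := regular_gt1 l_reg.
have [_ [g0 [Bg0 g0t] _] _] := is_sup_gt tsup yl.
exists (sval z), (sval g0); split=> //; first exact: (svalP z).
move=> v vl; have [_ [g [Bg gt] <-] vg] := is_sup_gt tsup vl.
exists (sval g); split=> //; last by rewrite colorE.
by apply/fiber_restr_agree; rewrite g0t gt.
Qed.

Lemma branches_cofinal T : big_trees c T -> cofinal_in k (branches c T).
Proof.
move=> Tsup; split=> [_ [b _ <-]|x xk]; first exact: (svalP b).
by have [y Ty /ltW xy] := is_sup_gt Tsup xk; exists y.
Qed.

Definition tree_of (B : set O) : set (seqlt l l) :=
  [set p | exists2 b : seg k, B (sval b) & projT2 p = fiber_restr c b (projT1 p)].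

Lemma big_tree_sup (T : set (seqlt l l)) (B : set O) :
  cofinal_in k B -> B `<=` branches c T -> big_trees c T.
Proof.
move=> [_ Bcof] BT; apply: cofinal_is_sup; first exact: regular_no_max.
split=> [_ [b _ <-]|x /Bcof[b /BT Tb xb]]; first exact: (svalP b).
by exists b.
Qed.

Lemma big_tree_of (B : set O) : cofinal_in k B -> big_trees c (tree_of B).
Proof.
move=> Bcof; apply: (big_tree_sup Bcof) => b Bb.
by exists (exist _ b (Bcof.1 _ Bb)) => // z; exists (exist _ b (Bcof.1 _ Bb)).
Qed.

Lemma big_treeT : big_trees c setT.
Proof.
apply: (@big_tree_sup _ (below k)); last by move=> b bk; exists (exist _ b bk).
by split=> // x xk; exists x.
Qed.

Lemma tree_of_agree (T : set (seqlt l l)) (B : set O) g z : T `<=` tree_of B ->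
  branches c T g -> z < l -> exists2 b, B b & agree color z g b.
Proof.
move=> TB [b bT <-] zl; have [b' Bb' /= E] := TB _ (bT (exist _ z zl)).
by exists (sval b') => //; apply/(fiber_restr_agree (exist _ z zl)).
Qed.

End Trees.

(** * Assembly of the family *)

Section Assembly.
Context {d : Order.disp_t} {O : orderType d} (wo : well_ordered O).
Implicit Types (a b x y z i j t : O).

Lemma full_cofinal k (B : set O) : is_cardinal k -> B `<=` below k ->
  B #= below k -> cofinal_in k B.
Proof.
move=> kcard Bk /card_eqPle[_ kB].
apply: contrapT => nB; have [s sk sP] := not_cofinal Bk nB.
move/negP: (kcard s sk); apply; apply: card_le_trans kB _.
by apply: subset_card_le => b /sP.
Qed.

(** [B] is the union of the [l < k] pieces [e b < v], so by regularity of [k] one of them is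
    cofinal. *)
Lemma cofinal_bounded_color l k (B : set O) (e : O -> O) :
  regular_cardinal l -> regular_cardinal k -> l < k -> (forall b, e b < l) ->
  cofinal_in k B -> exists2 v, v < l & cofinal_in k [set b | B b /\ e b < v].
Proof.
move=> lreg kreg lk el Bcof; apply: contrapT => nv.
have /choice[p pP] : forall v, exists s, v < l -> s < k /\
    forall b, B b -> e b < v -> b < s.
  move=> v; have [vl|] := boolP (v < l); last by exists v.
  have [b [/Bcof.1]//|vc|s sk sP] := @not_cofinal _ _ k [set b | B b /\ e b < v].
    by apply: nv; exists v.
  by exists s => _; split=> // b Bb ebv; apply: sP.
have [v /pP[]//|s sk sP] := cf_bound (F := p) kreg.2 lk.
have [b Bb sb] := Bcof.2 s sk.
have [v ebv vl] := regular_no_max lreg (el b).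
have := lt_trans ((pP v vl).2 b Bb ebv) (sP v vl).
by rewrite ltNge sb.
Qed.

Lemma cf_limit a l : regular_cardinal l -> is_cf a l -> limit_ordinal a.
Proof.
move=> lreg acf; split; last exact: cf_no_max acf (regular_gt1 lreg).
have [F Fa _] := cofinal_map_total acf.1.
by have [x [y [_ yl]]] := regular_gt1 lreg; exists (F y); apply: Fa.
Qed.

(** [T] and [F] are found for each [B] separately, and [a] serves for [B] as soon as the code of [T]
    occurs somewhere in [sg a]; this is what lets several sets [B] be combined. *)
Lemma ex_ad_family (theta lambda kappa : O)
  (theta_card : infinite_cardinal theta)
  (lambda_reg : regular_cardinal lambda)
  (kappa_reg : regular_cardinal kappa)
  (theta_le_lambda : theta <= lambda)
  (lambda_lt_kappa : lambda < kappa)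
  (c : seg lambda -> seg kappa -> seg lambda)
  (c_unbounded : strongly_unbounded c)
  (chi : O) (D : set (set (seqlt lambda lambda)))
  (D_dense : dense_trees c D) (D_chi : D #<= below chi)
  (chi_pow : [set: seqlt theta chi] #<= below kappa)
  (Z : set O) (SS : set (set O))
  (Z_cof : Z `<=` cof_set kappa lambda)
  (Z_stat : stationary kappa Z)
  (Z_nonrefl : nonreflecting kappa Z)
  (SS_part : partition SS id Z)
  (SS_stat : forall S, SS S -> stationary kappa S) :
  exists (code : set (seqlt lambda lambda) -> O) (sg : O -> seqlt theta chi)
    (A : O -> O -> set O),
  [/\ forall T, D T -> code T < chi,
      forall S q, SS S -> hits_closed kappa [set a | S a /\ sg a = q],
      forall a i i' b, Z a -> A a i b -> A a i' b -> i = i',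
      forall a i, Z a -> i < lambda -> cofinal_in a (A a i) &
   (forall a a' i i', Z a -> Z a' -> a' < a ->
     exists2 x, x < a' & forall b, A a i b -> A a' i' b -> b < x) /\
   forall B, cofinal_in kappa B -> exists T (F : O -> O),
     [/\ D T, closed_under F kappa &
       forall a i x q (t : seg (sval (projT1 q))), Z a -> closed_under F a ->
         sg a = q -> sval (projT2 q t) = code T -> i < lambda -> x < a ->
         exists b, [/\ A a i b, B b & x <= b]]].
Proof.
set l := lambda; set k := kappa; set cc := color c.
have l_inf : infinite_set (below l) := lambda_reg.1.2.
have cc_lt := @color_lt _ _ l k c.
have cc_unb := color_unbounded lambda_reg c_unbounded.
have Zk a : Z a -> a < k by move=> /Z_cof[].
have Zcf a : Z a -> is_cf a l by move=> /Z_cof[].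
have Zlim a : Z a -> limit_ordinal a by move=> /Zcf; apply: cf_limit.
have Zhit := stationary_hits_closed wo l_inf lambda_lt_kappa kappa_reg Z_stat.
have [h _ h_fib] := ex_cofinal_fibers wo lambda_reg.
have [e e_lt e_unb] := ex_unbounded_tails wo lambda_reg.
have /choice[gr grP] : forall a, exists p : (O -> O) * (O -> O), Z a ->
    [/\ [/\ forall j, j < l -> p.1 j < a,
      forall i j, i < j -> j < l -> p.1 i < p.1 j,
      forall x, x < a -> exists2 j, j < l & x <= p.1 j &
      forall j, j < l -> j <= e (p.1 j)] &
    [/\ forall b, b < a -> p.2 b < l,
      forall b j, b < a -> j < l -> p.1 j < b -> j < p.2 b,
      forall dl, is_cf dl l -> dl < a -> exists2 x, x < dl &
        exists2 j, j < l & forall b, x <= b -> b < dl -> p.2 b = j &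
      forall j, j < l -> p.2 (p.1 j) = j]].
  move=> a; have [Za|] := pselect (Z a); last by exists (id, id).
  have [g [g1 g2 g3 g4]] := ex_ladder wo e_unb (Zcf _ Za).
  have [rho rhoP] := ex_rank wo g1 g2 g3.
  by exists (g, rho).
pose g a := (gr a).1; pose rho a := (gr a).2.
have /choice[E EP] : forall a, exists E, a < k -> cofinal_in a E /\
    forall dl, Z dl -> dl < a -> exists2 x, x < dl & forall y, E y -> x <= y -> dl <= y.
  move=> a; have [ak|] := boolP (a < k); last by exists set0.
  by have [E] := ex_separated wo Zlim Z_nonrefl ak; exists E.
have [th0 th0_lt] := infinite_setN0 theta_card.2.
have [bot botP] := ex_bot wo l.
have bot_lt : bot < theta := le_lt_trans (botP th0) th0_lt.
have s0 : seqlt theta chi.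
  exists (exist _ bot bot_lt) => -[x /= xbot]; exfalso.
  by move: xbot; rewrite ltNge botP.
have SSZ S a : SS S -> S a -> Z a.
  by move=> SSS Sa; case: SS_part => <- _ _; exists S.
have [sg sgP] : exists sg : O -> seqlt theta chi, forall S q, SS S ->
    hits_closed k [set a | S a /\ sg a = q].
  (* Each member of [SS] gets its own guessing function; the members being disjoint, these are glued
     together. *)
  have /choice[s sP] : forall S, exists s : O -> seqlt theta chi, SS S ->
      forall q, hits_closed k [set a | S a /\ s a = q].
    move=> S; have [SSS|] := pselect (SS S); last by exists (fun=> s0).
    have [| | |s sP] := ex_stationary_guess wo s0 (S := S) (g := g) l_inf lambda_lt_kappa kappa_reg
      (SS_stat S SSS) _ _ _ chi_pow.
    - by move=> a /(SSZ S a SSS)/Zlim.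
    - by move=> a j /(SSZ S a SSS)/grP[[+ _ _ _] _]; apply.
    - by move=> a x /(SSZ S a SSS)/grP[[_ _ + _] _]; apply.
    by exists s.
  have /choice[w wP] : forall a, exists S, (exists2 S, SS S & S a) -> SS S /\ S a.
    move=> a; have [[S SSS Sa]|] := pselect (exists2 S, SS S & S a); last by exists set0.
    by exists S.
  exists (fun a => s (w a) a) => S q SSS F Fk.
  have [a [Sa sa] aF] := sP S SSS q F Fk; exists a => //; split=> //.
  have [SSw wa] : SS (w a) /\ w a a by apply: wP; exists S.
  case: SS_part => _ SStriv _.
  by have -> : w a = S by apply: SStriv => //; exists a.
have [fT fT_lt fT_inj] := card_le_inj chi D_chi.
(* [dd] decodes ordinals into trees; the full tree stands for an ordinal that is no code. *)
have /choice[dd ddP] : forall x, exists T, big_trees c T /\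
    forall T', D T' -> fT T' = x -> T = T'.
  move=> x; have [[T DT fTx]|nT] := pselect (exists2 T, D T & fT T = x).
    exists T; split; first exact: D_dense.1.
    by move=> T' DT'; rewrite -fTx => /fT_inj ->.
  exists setT; split; first exact: big_treeT.
  by move=> T' DT' fT'; case: nT; exists T'.
pose TT (s : seqlt theta chi) t := if pselect (t < sval (projT1 s)) is left p
  then dd (sval (projT2 s (exist _ t p))) else setT.
have TT_big s t : big_trees c (TT s t).
  by rewrite /TT; case: pselect => [p|?]; [case: (ddP (sval (projT2 s (exist _ t p))))|exact: big_treeT].
pose Gam a t := branches c (TT (sg a) t).
have Gam_cof a t : cofinal_in k (Gam a t) by exact: branches_cofinal.
have /choice[lv lvP] : forall G, exists z, cofinal_in k G -> z < l /\
    forall j, j < l -> cofinal_in k [set b | G b /\ j <= cc z b].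
  move=> G; have [Gc|] := pselect (cofinal_in k G); last by exists l.
  by have [z zl zP] := ex_unbounded_level kappa_reg lambda_lt_kappa cc_unb Gc; exists z.
pose lev a t := lv (Gam a t).
have lev_lt a t : lev a t < l by have [] := lvP _ (Gam_cof a t).
(* Beyond the length of [sg a] the tree is always [setT], so just one level [u] is added to fewer
   than [theta <= lambda] others. *)
have /choice[hm hmP] : forall a, exists hm, hm < l /\ forall t, lev a t <= hm.
  move=> a; have len_l : sval (projT1 (sg a)) < l.
    exact: lt_le_trans (svalP (projT1 (sg a))) theta_le_lambda.
  have [t _|v vl vP] := cf_bound (F := lev a) lambda_reg.2 len_l; first exact: lev_lt.
  pose u := lv (branches c setT).
  have ul : u < l by have [] := lvP _ (branches_cofinal (big_treeT c kappa_reg)).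
  exists (Order.max v u); split=> [|t]; first by rewrite gt_max vl.
  rewrite le_max; have [/vP/ltW ->//|nt] := boolP (t < sval (projT1 (sg a))).
  rewrite /lev /Gam /TT; case: pselect => [p|?]; first by rewrite p in nt.
  by rewrite lexx orbT.
have [| |m [m_lt m_ge m_le]] := ex_levels wo (l := l) (hm := hm) _ _ EP.
- by have [x [y [_ yl]]] := regular_gt1 lambda_reg; exists y.
- by move=> a _; case: (hmP a).
have /choice[pk pkP] : forall p : O * O, exists pk : O -> O -> O, Z p.1 -> p.2 < l ->
    (forall i t, i < l -> t < l ->
       [/\ Gam p.1 t (pk i t) /\ p.2 <= cc (lev p.1 t) (pk i t),
           p.1 <= pk i t & pk i t < k]) /\
    forall i i' t t', i < l -> i' < l -> t < l -> t' < l -> i <> i' ->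
      exists2 z, z < l & cc z (pk i t) <> cc z (pk i' t').
  move=> [a j] /=; have [Za|] := pselect (Z a); last by exists (fun _ => id).
  have [jl|] := boolP (j < l); last by exists (fun _ => id).
  have [|pk pkP] := ex_picks wo kappa_reg lambda_lt_kappa cc_lt cc_unb (Zk _ Za)
    (X := fun _ t => [set b | Gam a t b /\ j <= cc (lev a t) b]).
    by move=> i t _ _; apply: (lvP _ (Gam_cof a t)).2.
  by exists pk.
have /choice[thr thrP] : forall p : O * O, exists v, Z p.1 -> p.2 < l -> v < l /\
    (forall i t z, i < p.2 -> t < p.2 -> z <= hm p.1 -> cc z (pk p i t) <= v) /\
    forall i i' t t', i < p.2 -> i' < p.2 -> t < p.2 -> t' < p.2 -> i <> i' ->
      exists2 z, cc z (pk p i t) <> cc z (pk p i' t') &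
        forall y, y <= z -> cc y (pk p i t) <= v.
  move=> [a j] /=; have [Za|] := pselect (Z a); last by exists a.
  have [jl|] := boolP (j < l); last by exists a.
  have [pk1 pk2] := pkP (a, j) Za jl.
  have [| | |v vl vP] := ex_threshold lambda_reg cc_lt (hm := hm a) (pk := pk (a, j)) _ jl.
  - by case: (hmP a).
  - by move=> i t ij tj; have [] := pk1 i t (lt_trans ij jl) (lt_trans tj jl).
  - move=> i i' t t' ij i'j tj t'j; apply: pk2; exact: (lt_trans _ jl).
  by exists v.
have g_lt a j : Z a -> j < l -> g a j < a by move=> /grP[[+ _ _ _] _]; apply.
have g_mono a i j : Z a -> i < j -> j < l -> g a i < g a j.
  by move=> /grP[[_ + _ _] _]; apply.
have g_cof a x : Z a -> x < a -> exists2 j, j < l & x <= g a j.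
  by move=> /grP[[_ _ + _] _]; apply.
have g_e a j : Z a -> j < l -> j <= e (g a j) by move=> /grP[[_ _ _ +] _]; apply.
have rho_lt a b : Z a -> b < a -> rho a b < l by move=> /grP[_ [+ _ _ _]]; apply.
have rho_gt a b j : Z a -> b < a -> j < l -> g a j < b -> j < rho a b.
  by move=> /grP[_ [_ + _ _]]; apply.
have rho_const a dl : Z a -> is_cf dl l -> dl < a ->
    exists2 x, x < dl & exists2 j, j < l & forall b, x <= b -> b < dl -> rho a b = j.
  by move=> /grP[_ [_ _ + _]]; apply.
have rho_g a j : Z a -> j < l -> rho a (g a j) = j by move=> /grP[_ [_ _ _ +]]; apply.
have hm_lt a : Z a -> hm a < l by case: (hmP a).
have lev_le a t : Z a -> t < l -> lev a t <= hm a by case: (hmP a).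
have pkP' a j i t : Z a -> j < l -> i < l -> t < l -> [/\ Gam a t (pk (a, j) i t),
    a <= pk (a, j) i t, pk (a, j) i t < k & j <= cc (lev a t) (pk (a, j) i t)].
  by move=> Za jl il tl; have [/(_ i t il tl)[[? ?] ? ?] _] := pkP (a, j) Za jl.
have thr_lt a j : Z a -> j < l -> thr (a, j) < l.
  by move=> Za jl; have [] := thrP (a, j) Za jl.
have thr_hm a j i t z : Z a -> j < l -> i < j -> t < j -> z <= hm a ->
    cc z (pk (a, j) i t) <= thr (a, j).
  by move=> Za jl; have [_ [+ _]] := thrP (a, j) Za jl; apply.
have thr_sep a j i i' t t' : Z a -> j < l -> i < j -> i' < j -> t < j -> t' < j ->
    i <> i' -> exists2 z, cc z (pk (a, j) i t) <> cc z (pk (a, j) i' t') &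
      forall y, y <= z -> cc y (pk (a, j) i t) <= thr (a, j).
  by move=> Za jl; have [_ [_ +]] := thrP (a, j) Za jl; apply.
pose pk' a j := pk (a, j); pose thr' a j := thr (a, j).
exists fT, sg, (ad_set l cc e h g rho m pk' thr'); split=> //.
- by move=> a i i' b; apply: ad_set_disjoint.
- by move=> a i; apply: ad_set_cofinal.
split; first by move=> a a' i i'; apply: (ad_set_ad lambda_reg cc_lt Zk Zcf h g_lt g_e
  rho_lt rho_gt rho_const hm_lt lev_le m_ge pkP' thr_hm).
move=> B Bcof.
(* [B] is cut down to a thin set on which [e] is bounded below [l], and [T] is a member of [D]
   inside the tree of that set. *)
have [eb ebl B1cof] := cofinal_bounded_color lambda_reg kappa_reg lambda_lt_kappa e_lt Bcof.
have [B' [n [s [B'B1 B'cof nk sk B'thin]]]] :=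
  ex_thin wo cc kappa_reg lambda_lt_kappa B1cof.
have [T DT TB'] := D_dense.2 _ (big_tree_of c kappa_reg B'cof).
have Tcof := branches_cofinal (D_dense.1 _ DT).
have B'eb b : B' b -> e b < eb by move=> /B'B1[].
have [F Fk FP] := ad_set_guess lambda_reg kappa_reg lambda_lt_kappa cc_lt cc_unb Zk Zcf
  Zhit h g_lt rho_gt rho_const m_lt m_le pkP' thr_lt B'thin nk sk B'cof.1 Tcof B'eb ebl
  (fun _ _ => tree_of_agree TB').
exists T, F; split=> // a i x q t Za aF sgq tT il xa; subst q.
have tl : sval t < l.
  apply: lt_le_trans theta_le_lambda; apply: lt_trans (svalP t) _.
  exact: (svalP (projT1 (sg a))).
have [|b [Ab B'b xb]] := FP a (sval t) i x Za aF tl _ il xa.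
  rewrite /Gam /TT; case: pselect => [p|/(_ (svalP t))//].
  have -> : exist _ (sval t) p = t by apply: seg_inj.
  by congr branches; apply: (ddP _).2.
by exists b; split=> //; have [] := B'B1 _ B'b.
Qed.

(** Each of fewer than [theta] sets asks for the code of its tree to occur in [sg a] and for [a] to
    be closed under its function; one guessed sequence and one dominating function meet all these
    demands. *)
Lemma club_ad_nonreflecting (theta lambda kappa : O)
  (theta_card : infinite_cardinal theta)
  (lambda_reg : regular_cardinal lambda)
  (kappa_reg : regular_cardinal kappa)
  (theta_le_lambda : theta <= lambda)
  (lambda_lt_kappa : lambda < kappa)
  (c : seg lambda -> seg kappa -> seg lambda)
  (c_unbounded : strongly_unbounded c)
  (chi : O) (D : set (set (seqlt lambda lambda)))
  (D_dense : dense_trees c D) (D_chi : D #<= below chi)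
  (chi_pow : [set: seqlt theta chi] #<= below kappa)
  (Z : set O) (SS : set (set O))
  (Z_cof : Z `<=` cof_set kappa lambda)
  (Z_stat : stationary kappa Z)
  (Z_nonrefl : nonreflecting kappa Z)
  (SS_part : partition SS id Z)
  (SS_stat : forall S, SS S -> stationary kappa S) :
  club_ad kappa [set S `&` below kappa | S in SS] lambda theta.
Proof.
have [code [sg [A [code_lt sgP A_disj A_cof [A_ad A_guess]]]]] := ex_ad_family
  theta_card lambda_reg kappa_reg theta_le_lambda lambda_lt_kappa c_unbounded D_dense
  D_chi chi_pow Z_cof Z_stat Z_nonrefl SS_part SS_stat.
have SSZ S a : SS S -> S a -> Z a.
  by move=> SSS Sa; case: SS_part => <- _ _; exists S.
have Zk a : Z a -> a < kappa by move=> /Z_cof[].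
have Zlim a : Z a -> limit_ordinal a by move=> /Z_cof[_]; apply: cf_limit.
have SZ a : (\bigcup_(S in [set S `&` below kappa | S in SS]) S) a -> Z a.
  by move=> [_ [S SSS <-] [Sa _]]; apply: SSZ Sa.
pose AA a : set (set O) := [set A a i | i in below lambda].
exists AA; split.
- move=> a /SZ Za _; split.
  + by move=> _ _ [i il <-] [i' il' <-] [b [/= Ab Ab']]; rewrite (A_disj _ _ _ _ Za Ab Ab').
  + apply: inj_card_eq => i i' /set_mem il /set_mem i'l E.
    have [[x xa] _] := Zlim _ Za; have [b Ab _] := (A_cof a i Za il).2 x xa.
    by apply: (A_disj a i i' b) => //; rewrite -E.
  + by move=> _ [i il <-]; apply: A_cof.
- move=> BB BBP [_ /negP thetaBB] _ [S SSS <-].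
  have BBcof B : BB B -> cofinal_in kappa B.
    by move=> /BBP[Bk Bcard]; apply: full_cofinal => //; case: kappa_reg => -[].
  (* [theta] does not inject into [BB], so [BB] is listed by some [n < theta]. *)
  have [[f [fBB finj]]|[n [f [ntheta fsur]]]] := ex_enumeration wo set0 BB theta.
    by case: thetaBB; apply: (inj_card_le_set (f := f)).
  have nk : n < kappa.
    by apply: lt_trans lambda_lt_kappa; apply: lt_le_trans theta_le_lambda.
  have /choice[TF TFP] : forall t, exists p : set (seqlt lambda lambda) * (O -> O),
      [/\ D p.1, closed_under p.2 kappa & BB (f t) ->
       forall a i x q (u : seg (sval (projT1 q))), Z a -> closed_under p.2 a ->
         sg a = q -> sval (projT2 q u) = code p.1 -> i < lambda -> x < a ->
         exists b, [/\ A a i b, f t b & x <= b]].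
    move=> t; have [/BBcof/A_guess[T [F [DT Fk FP]]]|nBB] := pselect (BB (f t)).
      by exists (T, F).
    have [T DT _] := D_dense.2 _ (big_treeT c kappa_reg).
    by exists (T, id); split.
  have TFD t : D (TF t).1 by case: (TFP t).
  pose q : seqlt theta chi := existT _ (exist _ n ntheta)
    (fun u => exist _ (code (TF (sval u)).1) (code_lt _ (TFD _))).
  have /choice[G GP] : forall x, exists y, x < kappa -> y < kappa /\
      forall t, t < n -> (TF t).2 x < y.
    move=> x; have [xk|] := boolP (x < kappa); last by exists x.
    have [t _|y yk yP] := cf_bound (F := fun t => (TF t).2 x) kappa_reg.2 nk.
      by have [_ + _] := TFP t; apply.
    by exists y.
  apply: (hits_closed_stationary kappa_reg).
  + by move=> a [[]].
  + by move=> a [[/(SSZ _ _ SSS)/Zlim]].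
  move=> F0 F0k.
  have [x xk|a [Sa sga] aC] := sgP S q SSS (fun x => Order.max (F0 x) (G x)).
    by rewrite gt_max F0k//=; have [] := GP x xk.
  have Za := SSZ _ _ SSS Sa; have ak := Zk _ Za.
  exists a; last by move=> x /aC; rewrite gt_max => /andP[].
  split=> // _ B [i il <-] BBB; have [t tn ftB] := fsur B BBB.
  apply: cofinal_is_sup; first exact: (Zlim _ Za).2.
  split=> [b [/(A_cof a i Za il).1]//|x xa].
  have [_ _] := TFP t; rewrite ftB => /(_ BBB a i x q (exist _ t tn)) [] //.
    move=> y ya; have := aC y ya; rewrite gt_max => /andP[_]; apply: lt_trans.
    exact: (GP y (lt_trans ya ak)).2.
  by move=> b [Ab Bb xb]; exists b.
- have supA a i : Z a -> i < lambda -> is_sup (A a i) a.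
    by move=> Za il; apply: cofinal_is_sup; [exact: (Zlim _ Za).2|exact: A_cof].
  move=> _ _ [_ [S SSS <-] [a [Sa _] [i il <-]]] [_ [S' SSS' <-] [a' [Sa' _] [i' i'l <-]]] ne.
  have Za := SSZ _ _ SSS Sa; have Za' := SSZ _ _ SSS' Sa'.
  (* An upper bound below [a] is enough. For [a < a'] almost disjointness gives one, for [a' < a]
     the second set lies below [a'], and for [a = a'] the two sets are disjoint. *)
  have lt_sup u : ubound (A a i `&` A a' i') u -> u < a ->
      sup_lt_sup (A a i `&` A a' i') (A a i).
    move=> /(ex_sup wo)[s sP su] ua; exists s, a; split=> //; first exact: supA.
    exact: le_lt_trans ua.
  case: (ltgtP a a') => [aa'|a'a|aa'].
  + have [x xa xP] := A_ad a' a i' i Za' Za aa'.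
    by apply: (lt_sup x) => // b [Ab A'b]; apply/ltW/xP.
  + apply: (lt_sup a') => // b [_ A'b]; apply/ltW; exact: (A_cof a' i' Za' i'l).1.
  + subst a'; have [[x xa] _] := Zlim _ Za.
    apply: (lt_sup x) => // b [Ab A'b]; case: ne.
    by rewrite (A_disj a i i' b).
Qed.

End Assembly.

Theorem theorem3p3 (d : Order.disp_t) (O : orderType d) (wo : well_ordered O)
  (theta lambda kappa : O)
  (theta_card : infinite_cardinal theta)
  (lambda_reg : regular_cardinal lambda)
  (kappa_reg : regular_cardinal kappa)
  (theta_le_lambda : theta <= lambda)
  (lambda_lt_kappa : lambda < kappa)
  (c : seg lambda -> seg kappa -> seg lambda)
  (c_unbounded : strongly_unbounded c)
  (c_tight : tight c)
  (chi : O) (chi_cf : is_cf_trees c chi)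
  (chi_pow : [set: seqlt theta chi] #<= below kappa)
  (Z : set O) (SS : set (set O))
  (Z_cof : Z `<=` cof_set kappa lambda)
  (Z_stat : stationary kappa Z)
  (Z_nonrefl : nonreflecting kappa Z)
  (SS_part : partition SS id Z)
  (SS_stat : forall S, SS S -> stationary kappa S) :
  (exists2 C, club kappa C &
     club_ad kappa [set S `&` C | S in SS] lambda theta) /\
  (is_succ_cardinal lambda kappa \/
     [set: seqlt lambda lambda] #= below lambda ->
   club_ad kappa [set S `&` below kappa | S in SS] lambda theta).
Proof.
have [_ [D D_dense /card_eqPle[D_chi _]] _] := chi_cf.
have ad : club_ad kappa [set S `&` below kappa | S in SS] lambda theta.
  exact: (club_ad_nonreflecting wo theta_card lambda_reg kappa_reg theta_le_lambda
    lambda_lt_kappa c_unbounded D_dense D_chi chi_pow Z_cof Z_stat).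
split=> //; exists (below kappa) => //; split=> //.
by split=> // x xk; exists x.
Qed.
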